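(* Let $g:[a,b]\to\mathbb R$ be a derivator. Then ${\rm P}_g$ is dense in $\mathrm{UC}_g([a,b])$ if and only if, for every $x\in D_g$, the indicator function $1_{\{x\}}$ (equal to $1$ at $x$ and $0$ elsewhere) belongs to the closure of ${\rm P}_g$ in $L^2_g([a,b])$.
   Context: $\mathbb F\in\{\mathbb R,\mathbb C\}$. A derivator is a nondecreasing, left-continuous $g:[a,b]\to\mathbb R$; $\mu_g$ is its Lebesgue–Stieltjes measure ($\mu_g([c,d))=g(d)-g(c)$). For $x\in[a,b)$, $\Delta g(x)=g(x^+)-g(x)$ and $D_g=\{x\in[a,b):\Delta g(x)>0\}$. For $x_0\in[a,b]$, the $g$-monomials centered at $x_0$ are $g_{x_0,0}\equiv1$, $g_{x_0,n}(x)=n\int_{[x_0,x)}g_{x_0,n-1}\,d\mu_g$ for $x\ge x_0$ and $g_{x_0,n}(x)=-n\int_{[x,x_0)}g_{x_0,n-1}\,d\mu_g$ for $x<x_0$. ${\rm P}_g$ is the space of finite $\mathbb F$-linear combinations of $g$-monomials. $L^2_g([a,b])$ is the Hilbert space of $\mu_g$-measurable $f$ with $\int_{[a,b)}|f|^2d\mu_g<\infty$. $\mathrm{UC}_g([a,b])$ is the Banach space (supremum norm) of uniformly $g$-continuous functions: for every $\varepsilon>0$ there is $\delta>0$ with $|g(x)-g(y)|<\delta\Rightarrow|f(x)-f(y)|<\varepsilon$ for all $x,y\in[a,b]$. *)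

(* Defs.v *)
From HB Require Import structures.
From mathcomp Require Import all_boot all_order all_algebra.
From mathcomp Require Import all_classical all_reals all_analysis.
From mathcomp Require Import complex.
Set Implicit Arguments. Unset Strict Implicit. Unset Printing Implicit Defensive.
Import Order.TTheory GRing.Theory Num.Theory.
Import numFieldNormedType.Exports.
Local Open Scope classical_set_scope.
Local Open Scope ring_scope.

Section Derivators.
Variable R : realType.

(** [g : [a,b] -> R] is a derivator: nondecreasing and left-continuous on
    [a,b].  Functions on [a,b] are represented as functions on R whose
    values outside [a,b] are irrelevant. *)
Definition derivator (a b : R) (g : R -> R) : Prop :=
  a < b /\
  {in `[a, b] &, {homo g : x y / x <= y}} /\
  (forall x, x \in `]a, b] -> g @ at_left x --> g x).

Definition gext (a b : R) (g : R -> R) : R -> R :=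
  fun x => g (Num.min (Num.max x a) b).

Definition greg (a b : R) (g : R -> R) : R -> R :=
  fun x => lim (gext a b g y @[y --> x^'+]).

Definition greg_cum (a b : R) (g : R -> R) : cumulative R R :=
  match pselect (nondecreasing (greg a b g) /\ right_continuous (greg a b g))
  with
  | left P => HB.pack (greg a b g)
                (isCumulative.Build R _ R (greg a b g) (proj1 P) (proj2 P))
  | right _ => [the cumulative R R of (@idfun R)]
  end.

(** The Lebesgue–Stieltjes measure mu_g, i.e. mu_g([c,d)) = g(d) - g(c)
    for a <= c <= d <= b.  Since g is left-continuous, this is the
    Lebesgue–Stieltjes measure (in the library's ]c,d]-convention) of the
    right-continuous function x |-> g(x^+) (g extended constantly). *)
Definition mu_g (a b : R) (g : R -> R) :=
  lebesgue_stieltjes_measure (greg_cum a b g).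

Definition gplus (g : R -> R) (x : R) : R := lim (g y @[y --> x^'+]).
Definition Deltag (g : R -> R) (x : R) : R := gplus g x - g x.
Definition Dg (a b : R) (g : R -> R) : set R :=
  [set x | a <= x < b /\ 0 < Deltag g x].

Fixpoint gmono (a b : R) (g : R -> R) (x0 : R) (n : nat) : R -> R :=
  match n with
  | 0 => fun _ => 1
  | k.+1 => fun x =>
      if x0 <= x then k.+1%:R * Rintegral (mu_g a b g) `[x0, x[ (gmono a b g x0 k)
      else - (k.+1%:R * Rintegral (mu_g a b g) `[x, x0[ (gmono a b g x0 k))
  end.

(** The scalar field F (R or C) is given by a numFieldType K together with
    the embedding emb : R -> K and the (real-valued) modulus absK : K -> R. *)
Section Scalars.
Variables (K : numFieldType) (emb : R -> K) (absK : K -> R).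

Definition Pg (a b : R) (g : R -> R) : set (R -> K) :=
  [set p | exists s : seq (K * R * nat),
     (forall t, t \in s -> a <= t.1.2 <= b) /\
     p = (fun x => \sum_(t <- s) t.1.1 * emb (gmono a b g t.1.2 t.2 x))].

Definition UCg (a b : R) (g : R -> R) : set (R -> K) :=
  [set f | forall eps : R, 0 < eps -> exists2 delta : R, 0 < delta &
     forall x y, x \in `[a, b] -> y \in `[a, b] ->
       `|g x - g y| < delta -> absK (f x - f y) < eps].

Definition Pg_dense_UCg (a b : R) (g : R -> R) : Prop :=
  forall f, UCg a b g f -> forall eps : R, 0 < eps ->
    exists2 p, Pg a b g p & forall x, x \in `[a, b] -> absK (f x - p x) < eps.

Definition ind1 (x : R) : R -> K := fun y => if y == x then 1 else 0.

Definition in_L2_closure_Pg (a b : R) (g : R -> R) (f : R -> K) : Prop :=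
  forall eps : R, 0 < eps -> exists2 p, Pg a b g p &
    (\int[mu_g a b g]_(y in `[a, b[) ((absK (f y - p y)) ^+ 2)%:E < eps%:E)%E.

End Scalars.
End Derivators.

(* Main.v *)
(** Integration f |-> int_[a,x) f dmu_g maps P_g into P_g and is continuous
    from L^1 to the sup norm, so it maps the L^1-closure V of P_g into its sup
    closure A.  If V contains the indicator of every jump, it contains h 1_D for
    every bounded h, where D = D_g.  Let u(x) = mu_g([a,x) \ D), a continuous
    function.  Then u^n in A gives u^n 1_{~D} in V, whose integral u^(n+1)/(n+1)
    is again in A; hence A contains all polynomials in u, and by polynomial
    approximation of |t| also min(u, u(y)).  Adding the integral of 1_D over
    [a,y) yields min(g, g(y)) in A, while integrating the indicator of a jump y
    yields the step 1_{(y,b]}.  Ramps and steps of these two kinds interpolate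
    any uniformly g-continuous function.  Conversely the indicator of a jump x is
    the L^2-limit of the tents max(0, 1 - |g - g(x)| / eta).  The complex case
    reduces to the real one by taking real and imaginary parts. *)
Require Import Defs.
From mathcomp Require Import all_boot all_order all_algebra.
From mathcomp Require Import all_classical all_reals all_analysis.
From mathcomp Require Import measurable_realfun complex ring lra.
Set Implicit Arguments. Unset Strict Implicit. Unset Printing Implicit Defensive.
Import Order.TTheory GRing.Theory Num.Theory.
Import numFieldNormedType.Exports.
Local Open Scope classical_set_scope.
Local Open Scope ring_scope.

(** * The Stieltjes measure of points and intervals in terms of g *)

Section derivator_measure.
Context {R : realType} {a b : R} {g : R -> R}.
Hypothesis dg : derivator a b g.

Let ab : a < b. Proof. by case: dg. Qed.

Lemma derivator_homo x y : a <= x -> x <= y -> y <= b -> g x <= g y.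
Proof.
case: dg => _ [h _] ax xy yb; apply: h => //; rewrite in_itv/=.
  by rewrite ax (le_trans xy).
by rewrite yb (le_trans ax).
Qed.

Lemma derivator_left x eps : a < x -> x <= b -> 0 < eps ->
  exists y, [/\ a <= y, y < x & g x - eps < g y].
Proof.
move=> ax xb e0; case: dg => _ [_ /(_ x)].
rewrite in_itv/= ax xb => /(_ isT) /cvgrPdist_lt/(_ _ e0) gx.
have [y [+ [yx ay]]] := @filter_ex _ _ (at_left_proper_filter x) _
  (filterI gx (filterI (nbhs_left_lt x) (nbhs_left_ge ax))).
by rewrite ltr_norml => /andP[_ h]; exists y; split => //; lra.
Qed.

Lemma gextE x : a <= x <= b -> gext a b g x = g x.
Proof.
by move=> /andP[ax xb]; rewrite /gext (max_idPl ax) (min_idPl xb).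
Qed.

Lemma gext_homo : {homo gext a b g : x y / x <= y}.
Proof.
move=> x y xy; rewrite /gext; apply: derivator_homo.
- by rewrite le_min le_max lexx orbT ltW.
- by rewrite le_min2// le_max2.
- by rewrite ge_min lexx orbT.
Qed.

(** The extension is constant on ]-oo, a] and on [b, +oo[, so left-continuity of g on ]a, b] makes
    it left-continuous on the whole line. *)
Lemma gext_left x eps : 0 < eps -> exists2 y, y < x & gext a b g x - eps < gext a b g y.
Proof.
move=> e0; case: (leP x a) => xa.
  exists (x - 1); first by rewrite ltrBlDr ltrDl.
  have ya : x - 1 <= a by lra.
  by rewrite /gext (max_idPr xa) (max_idPr ya) ltrBlDr ltrDl.
case: (leP x b) => xb; last first.
  exists b => //; rewrite /gext (max_idPl (ltW xa)) (min_idPr (ltW xb)).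
  by rewrite (max_idPl (ltW ab)) minxx ltrBlDr ltrDl.
have [y [ay yx gy]] := derivator_left xa xb e0.
exists y => //; rewrite !gextE// ?(ltW xa)// ay/= (le_trans (ltW yx))//.
Qed.

(** A nondecreasing function has its infimum over ]x, +oo[ as right limit at x. In this form the
    estimates below need only order and no limits. *)
Lemma gregE x : greg a b g x = inf (gext a b g @` `]x, +oo[).
Proof.
apply/cvg_lim => //; apply: (@nondecreasing_at_right_cvgr _ _ _ +oo%O) => //.
  by move=> y z _ _; exact: gext_homo.
exists (gext a b g x) => _ /= [y + <-]; rewrite in_itv/= andbT => /ltW xy.
exact: gext_homo.
Qed.

Let has_inf_gext x : has_inf (gext a b g @` `]x, +oo[).
Proof.
split.
  exists (gext a b g (x + 1)); exists (x + 1) => //.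
  by rewrite /= in_itv/= andbT ltrDl.
exists (gext a b g x) => _ /= [y + <-]; rewrite in_itv/= andbT => /ltW xy.
exact: gext_homo.
Qed.

Lemma greg_le x y : x < y -> greg a b g x <= gext a b g y.
Proof.
move=> xy; rewrite gregE; apply: ge_inf; first by case: (has_inf_gext x).
by exists y => //=; rewrite in_itv/= andbT.
Qed.

Lemma greg_ge x : gext a b g x <= greg a b g x.
Proof.
rewrite gregE; apply: lb_le_inf; first by case: (has_inf_gext x).
by move=> _ [y /= + <-]; rewrite in_itv/= andbT => /ltW xy; exact: gext_homo.
Qed.

Lemma greg_right x eps : 0 < eps ->
  exists2 y, x < y & gext a b g y < greg a b g x + eps.
Proof.
move=> e0; have [_ [y /= + <-]] := inf_adherent e0 (has_inf_gext x).
by rewrite in_itv/= andbT gregE => xy ?; exists y.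
Qed.

Lemma greg_homo : nondecreasing (greg a b g).
Proof.
move=> x y; rewrite le_eqVlt => /predU1P[->//|xy].
exact: le_trans (greg_le xy) (greg_ge y).
Qed.

Lemma greg_right_continuous : right_continuous (greg a b g).
Proof.
move=> x; apply/cvgrPdist_lt => e e0.
have [y xy gy] := greg_right x e0.
near=> z.
have xz : x < z by near: z; exact: nbhs_right_gt.
have zy : z < y by near: z; exact: nbhs_right_lt.
have := greg_le zy; have := greg_homo (ltW xz).
by move=> ? ?; rewrite ltr_norml; apply/andP; split; lra.
Unshelve. all: by end_near. Qed.

(** For a derivator the test in [greg_cum] succeeds, so the fallback to the identity never enters
    [mu_g]. *)
Lemma greg_cumE : greg_cum a b g = greg a b g :> (R -> R).
Proof.
rewrite /greg_cum; case: pselect => //.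
by case; split; [exact: greg_homo|exact: greg_right_continuous].
Qed.

Lemma gplusE x : a <= x < b -> gplus g x = greg a b g x.
Proof.
move=> /andP[ax xb]; rewrite /gplus /greg; congr (lim _).
have e : {near x^'+, g =1 gext a b g}.
  near=> y; rewrite gextE//; apply/andP; split.
    by apply: le_trans ax _; apply: ltW; near: y; exact: nbhs_right_gt.
  by near: y; exact: nbhs_right_le.
apply/seteqP; split; apply: near_eq_cvg => //.
by apply: filterS e => y ->.
Unshelve. all: by end_near. Qed.

(** [mu_g] ascribed the type of measures, so that the general measure lemmas apply to it. *)
Definition mug : {measure set (measurableTypeR R) -> \bar R} := mu_g a b g.
Arguments mug : simpl never.

Lemma mug_oc (c d : R) : c <= d ->
  mug `]c, d]%classic = (greg a b g d - greg a b g c)%:E.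
Proof.
rewrite le_eqVlt => /predU1P[->|cd].
  by rewrite subrr set_itvoc0 measure0.
rewrite /mug/= /mu_g /lebesgue_stieltjes_measure/= /measure_extension/=.
rewrite measurable_mu_extE/=; last exact: is_ocitv.
by rewrite wlength_itv/= lte_fin cd greg_cumE EFinB.
Qed.

Let natinv_lt (d : R) : 0 < d -> \forall n \near \oo, n.+1%:R^-1 < d.
Proof. by move=> d0; near=> n; near: n; exact: near_infty_natSinv_lt (PosNum d0).
Unshelve. all: by end_near. Qed.

(** The point is the intersection of the intervals ]x - 1/(n+1), x]. Once x - 1/(n+1) exceeds some y
    < x, its right limit lies between [gext y] and [gext x], and left-continuity brings these
    together. *)
Lemma mug_set1 (x : R) : mug [set x] = (greg a b g x - gext a b g x)%:E.
Proof.
pose F n : set R := `]x - n.+1%:R^-1, x]%classic.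
have FE n : mug (F n) = (greg a b g x - greg a b g (x - n.+1%:R^-1))%:E.
  by rewrite mug_oc// lerBlDr lerDl.
have c1 : mug \o F @ \oo --> mug (\bigcap_n F n).
  apply: nonincreasing_cvg_mu.
  - by rewrite FE ltry.
  - by move=> n; exact: measurable_itv.
  - by apply: bigcap_measurable => // n _; exact: measurable_itv.
  - move=> n m nm; apply/subsetPset => y; rewrite /F/= !in_itv/= => /andP[h ->].
    rewrite andbT (le_lt_trans _ h)// lerB// lef_pV2 ?posrE ?ltr0n// ler_nat.
    by rewrite ltnS.
have IE : \bigcap_n F n = [set x].
  apply/seteqP; split => [y Fy|_ -> n _]; last first.
    by rewrite /F/= in_itv/= lexx andbT ltrBlDr ltrDl.
  have yx : y <= x by have := Fy 0 I; rewrite /F/= in_itv/= => /andP[].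
  apply/eqP; rewrite eq_le yx/= leNgt; apply/negP => yx'.
  have d0 : 0 < x - y by rewrite subr_gt0.
  have [n _ /(_ n (leqnn n)) nxy] := natinv_lt d0.
  by have := Fy n I; rewrite /F/= in_itv/= => /andP[h _]; move: h; rewrite ltrBlDr -ltrBlDl => /lt_trans/(_ nxy); rewrite ltxx.
rewrite IE in c1; apply: cvg_unique c1 _ => //.
have -> : mug \o F = EFin \o (fun n => greg a b g x - greg a b g (x - n.+1%:R^-1)).
  by apply/funext => n /=; rewrite FE.
apply: cvg_EFin; first by near=> n.
apply/cvgrPdist_lt => e e0.
have [y yx gy] := gext_left x e0.
have d0 : 0 < x - y by rewrite subr_gt0.
near=> n.
have h : n.+1%:R^-1 < x - y by near: n; exact: natinv_lt.
have h1 : gext a b g y <= greg a b g (x - n.+1%:R^-1).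
  by apply: le_trans (greg_ge _); apply: gext_homo; rewrite lerBrDl -lerBrDr ltW.
have h2 : greg a b g (x - n.+1%:R^-1) <= gext a b g x.
  by apply: greg_le; rewrite ltrBlDr ltrDl.
move=> /=; move: (greg a b g (x - n.+1%:R^-1)) h1 h2 => r h1 h2.
rewrite ltr_norml; apply/andP; split; lra.
Unshelve. all: by end_near. Qed.

(** [c, d] splits both as {c} with ]c, d] and as [c, d[ with {d}; comparing the two exchanges the
    atom at d for the atom at c. *)
Lemma mug_co (c d : R) : a <= c -> c <= d -> d <= b ->
  mug `[c, d[%classic = (g d - g c)%:E.
Proof.
move=> ac; rewrite le_eqVlt => /predU1P[->|cd] db.
  by rewrite subrr set_itvco0 measure0.
have e1 : mug `[c, d]%classic = (mug [set c] + mug `]c, d]%classic)%E.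
  rewrite -measureU//; first by rewrite (setU1itv false)// bnd_simp ltW.
  by apply/seteqP; split => // x [/= ->]/=; rewrite in_itv/= ltxx.
have e2 : mug `[c, d]%classic = (mug `[c, d[%classic + mug [set d])%E.
  rewrite -measureU//; first by rewrite (setUitv1 true)// bnd_simp ltW.
  by apply/seteqP; split => // x [/= + xd]; rewrite xd in_itv/= ltxx andbF.
move: e2; rewrite e1 !mug_set1 mug_oc ?(ltW cd)//.
rewrite !gextE ?(ltW (le_lt_trans ac cd)) ?ac//; last by rewrite (le_trans (ltW cd)).
(* A finite upper bound on the unknown measure lets the equation be solved in R rather than in the
   extended reals. *)
have : (mug `[c, d[%classic <= mug `](c - 1)%R, d]%classic)%E.
  apply: le_measure; rewrite ?inE; try exact: measurable_itv.
  by move=> x /=; rewrite !in_itv/= => /andP[? /ltW ->]; rewrite andbT; lra.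
rewrite mug_oc; last by lra.
have := measure_ge0 mug `[c, d[%classic.
move: (mug `[c, d[%classic) => -[r||]//= _ _.
rewrite -!EFinD => -[h]; congr (_%:E); lra.
Qed.

Lemma mug_set1_jump (x : R) : a <= x < b -> mug [set x] = (Deltag g x)%:E.
Proof.
move=> /[dup] axb /andP[ax xb].
by rewrite mug_set1 /Deltag gplusE// gextE// ax ltW.
Qed.

Lemma mug_oo (c d : R) : a <= c -> c < d -> d <= b ->
  mug `]c, d[%classic = (g d - gplus g c)%:E.
Proof.
move=> ac cd db.
have acb : a <= c < b by rewrite ac (lt_le_trans cd).
have : mug `[c, d[%classic = (mug [set c] + mug `]c, d[%classic)%E.
  rewrite -measureU//; first by rewrite setU1itv ?bnd_simp.
  by apply/seteqP; split => // x [/= ->]/=; rewrite in_itv/= ltxx.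
rewrite mug_co// ?(ltW cd)// mug_set1_jump//.
have : (mug `]c, d[%classic <= mug `[c, d[%classic)%E.
  apply: le_measure; rewrite ?inE; try exact: measurable_itv.
  exact: subset_itvW.
rewrite mug_co ?(ltW cd)//; have := measure_ge0 mug `]c, d[%classic.
move: (mug `]c, d[%classic) => -[r||]//= _ _.
by rewrite -!EFinD /Deltag => -[h]; congr (_%:E); lra.
Qed.

Lemma gplus_le (c d : R) : a <= c -> c < d -> d <= b -> gplus g c <= g d.
Proof.
by move=> ac cd db; rewrite -subr_ge0 -lee_fin -mug_oo.
Qed.

Lemma gplus_right x eps : a <= x < b -> 0 < eps ->
  exists y, [/\ x < y, y <= b & g y < gplus g x + eps].
Proof.
move=> /[dup] axb /andP[ax xb] e0.
have [y xy] := greg_right x e0; rewrite -gplusE// => gy.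
exists (Num.min y b); rewrite lt_min xy xb ge_min lexx orbT; split => //.
apply: le_lt_trans gy; rewrite -gextE; first apply: gext_homo.
  by rewrite ge_min lexx.
by rewrite le_min ge_min lexx orbT (ltW (le_lt_trans ax xy)) (ltW (le_lt_trans ax xb)).
Qed.

End derivator_measure.
Arguments mug {R} a b g : simpl never.

(** * Primitives, and the sup and L^1 closures of P_g *)

Section closures.
Context {R : realType} {a b : R} {g : R -> R}.
Hypothesis dg : derivator a b g.

Let ab : a < b. Proof. by case: dg. Qed.
Notation mu := (mug a b g).
Notation P := (Pg (@id R) a b g).

Definition L1 (f : R -> R) := mu.-integrable `[a, b[ (EFin \o f).
Definition norm1 (f : R -> R) := \int[mu]_(x in `[a, b[) `|f x|.
Definition prim (f : R -> R) (x : R) := \int[mu]_(y in `[a, x[) f y.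
Definition supcl (f : R -> R) := forall eps, 0 < eps ->
  exists2 p, P p & forall x, a <= x <= b -> `|f x - p x| < eps.
(** Integrability is required separately, because the real-valued integral turns an infinite value
    into 0 and [norm1] alone would not exclude it. *)
Definition L1cl (f : R -> R) := L1 f /\ forall eps, 0 < eps ->
  exists2 p, P p & norm1 (f \- p) < eps.

Let mab : measurable (`[a, b[%classic : set (measurableTypeR R)).
Proof. exact: measurable_itv. Qed.

Lemma mug_ab : mu `[a, b[%classic = (g b - g a)%:E.
Proof. by rewrite (mug_co dg)// ltW. Qed.

Let gab : 0 <= g b - g a.
Proof. by rewrite -lee_fin -mug_ab. Qed.

Lemma L1_bounded (f : R -> R) (M : R) : measurable_fun (`[a, b[%classic : set (measurableTypeR R)) f ->
  (forall x, a <= x < b -> `|f x| <= M) -> L1 f.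
Proof.
move=> mf fM; apply: measurable_bounded_integrable => //.
  by rewrite mug_ab ltry.
exists M; split; first by rewrite num_real.
by move=> r Mr x /=; rewrite in_itv/= => /fM h; rewrite (le_trans h)// ltW.
Qed.

(** Clamping the argument to [a, b] extends f to a nondecreasing, hence measurable, function on the
    line. On [a, b] it is bounded through its two end values. *)
Lemma L1_homo (f : R -> R) : (forall x y, a <= x -> x <= y -> y <= b -> f x <= f y) -> L1 f.
Proof.
move=> hf; pose F x := f (Num.min (Num.max x a) b).
have FE x : a <= x < b -> F x = f x.
  by move=> /andP[ax xb]; rewrite /F (max_idPl ax) (min_idPl (ltW xb)).
apply: (@L1_bounded _ (`|f a| + `|f b|)).
  have mF : measurable_fun (`[a, b[%classic : set (measurableTypeR R)) F.
    apply: nondecreasing_measurable => // x y xy; apply: hf.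
    - by rewrite le_min le_max lexx orbT ltW.
    - by rewrite le_min2// le_max2.
    - by rewrite ge_min lexx orbT.
  apply: eq_measurable_fun mF => x; rewrite inE/= in_itv/=; exact: FE.
move=> x /andP[ax xb].
have h1 := hf _ _ (lexx a) ax (ltW xb).
have h2 := hf _ _ ax (ltW xb) (lexx b).
rewrite ler_norml; have := ler_norm (f b); have := ler_norm (- f a).
rewrite normrN; have := normr_ge0 (f a); have := normr_ge0 (f b).
by move=> *; apply/andP; split; lra.
Qed.

Lemma L1_cst c : L1 (fun=> c).
Proof. by apply: L1_homo. Qed.

Lemma L1D f h : L1 f -> L1 h -> L1 (f \+ h).
Proof. by move=> lf lh; exact: (integrableD mab lf lh). Qed.

Lemma L1Z c f : L1 f -> L1 (fun x => c * f x).
Proof. by move=> lf; exact: (integrableZl mab c lf). Qed.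

Lemma L1B f h : L1 f -> L1 h -> L1 (f \- h).
Proof. by move=> lf lh; exact: (integrableB mab lf lh). Qed.

Lemma L1_abs f : L1 f -> L1 (fun x => `|f x|).
Proof. by move=> lf; exact: (integrable_norm lf). Qed.

Lemma L1_eq f h : (forall x, a <= x < b -> f x = h x) -> L1 f -> L1 h.
Proof.
move=> fh; apply: (eq_integrable mab) => x; rewrite inE/= in_itv/= => /fh.
by move=> /= ->.
Qed.

Lemma L1_sub f c d : L1 f -> a <= c -> d <= b -> mu.-integrable `[c, d[ (EFin \o f).
Proof.
move=> lf ac db; apply: integrableS lf => //.
by apply: subset_itv; rewrite bnd_simp.
Qed.

Lemma Rintegral_split f c d e : L1 f -> a <= c -> c <= d -> d <= e -> e <= b ->
  \int[mu]_(x in `[c, e[) f x =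
  \int[mu]_(x in `[c, d[) f x + \int[mu]_(x in `[d, e[) f x.
Proof.
move=> lf ac cd de eb; rewrite -Rintegral_setU//; try exact: measurable_itv.
- by congr Rintegral; rewrite -itv_bndbnd_setU// bnd_simp.
- rewrite -itv_bndbnd_setU ?bnd_simp//; exact: L1_sub.
- apply/disj_setPS => x /= [].
  by rewrite !in_itv/= => /andP[_ h] /andP[/(lt_le_trans h)]; rewrite ltxx.
Qed.

Lemma prim_sub f c d : L1 f -> a <= c -> c <= d -> d <= b ->
  prim f d - prim f c = \int[mu]_(x in `[c, d[) f x.
Proof.
move=> lf ac cd db; rewrite /prim (@Rintegral_split f a c d)//; lra.
Qed.

Lemma prim_a f : prim f a = 0.
Proof. by rewrite /prim set_itvco0 Rintegral_set0. Qed.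

Lemma le_norm1 f h : L1 f -> L1 h -> (forall x, a <= x < b -> `|f x| <= `|h x|) ->
  norm1 f <= norm1 h.
Proof.
move=> lf lh fh; by apply: le_Rintegral => //; exact: L1_abs.
Qed.

Lemma eq_norm1 f h : (forall x, a <= x < b -> f x = h x) -> norm1 f = norm1 h.
Proof.
by move=> fh; apply: eq_Rintegral => x; rewrite inE/= in_itv/= => /fh ->.
Qed.

Lemma norm1D f h : L1 f -> L1 h -> norm1 (f \+ h) <= norm1 f + norm1 h.
Proof.
move=> lf lh; rewrite /norm1 -RintegralD//; try exact: L1_abs.
apply: le_Rintegral => //; first exact/L1_abs/L1D.
  by apply: L1D; exact: L1_abs.
by move=> x _; exact: ler_normD.
Qed.

Lemma norm1Z c f : L1 f -> norm1 (fun x => c * f x) = `|c| * norm1 f.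
Proof.
move=> lf; rewrite /norm1 -RintegralZl//; last exact: L1_abs.
by apply: eq_Rintegral => x _; rewrite normrM.
Qed.

Lemma norm1_ge0 f : 0 <= norm1 f.
Proof. exact: Rintegral_ge0. Qed.

Lemma norm1_cst c : 0 <= c -> norm1 (fun=> c) = c * (g b - g a).
Proof.
by move=> c0; rewrite /norm1 Rintegral_cst//= ger0_norm// mug_ab.
Qed.

Lemma le_prim f x : L1 f -> a <= x <= b -> `|prim f x| <= norm1 f.
Proof.
move=> lf /andP[ax xb]; apply: le_trans (le_normr_Rintegral _ _) _ => //.
  exact: L1_sub.
rewrite /norm1 (@Rintegral_split (fun y => `|f y|) a x b)//; last exact: L1_abs.
by rewrite lerDl; exact: Rintegral_ge0.
Qed.

Lemma primD f h x : L1 f -> L1 h -> x <= b -> prim (f \+ h) x = prim f x + prim h x.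
Proof. by move=> lf lh xb; rewrite /prim -RintegralD//; exact: L1_sub. Qed.

Lemma primZ c f x : L1 f -> x <= b -> prim (fun y => c * f y) x = c * prim f x.
Proof. by move=> lf xb; rewrite /prim RintegralZl//; exact: L1_sub. Qed.

Lemma primB f h x : L1 f -> L1 h -> x <= b -> prim (f \- h) x = prim f x - prim h x.
Proof. by move=> lf lh xb; rewrite /prim -RintegralB//; exact: L1_sub. Qed.

Lemma prim_homo f : L1 f -> (forall x, a <= x < b -> 0 <= f x) ->
  forall x y, a <= x -> x <= y -> y <= b -> prim f x <= prim f y.
Proof.
move=> lf f0 x y ax xy yb; rewrite -subr_ge0 prim_sub//.
apply: Rintegral_ge0 => z /=; rewrite in_itv/= => /andP[xz zy].
by rewrite f0// (le_trans ax xz) (lt_le_trans zy).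
Qed.

(** Writing f as (|f| + f) - |f| exhibits the primitive as a difference of two nondecreasing
    functions. *)
Lemma L1_prim f : L1 f -> L1 (prim f).
Proof.
move=> lf; have la := L1_abs lf.
have lp : L1 (fun x => `|f x| + f x) by exact: L1D.
apply: (@L1_eq (prim (fun x => `|f x| + f x) \- prim (fun x => `|f x|))).
  by move=> x /andP[_ /ltW xb] /=; rewrite (primD la lf)//; lra.
apply: L1B; apply/L1_homo/prim_homo => // x _.
by have := ler_norm (- f x); rewrite normrN; lra.
Qed.

(** Both branches of the recursion are the same signed increment of a primitive started at a, which
    removes the case distinction on the side of the centre. *)
Lemma gmonoS x0 k x : L1 (gmono a b g x0 k) -> a <= x0 <= b -> a <= x <= b ->
  gmono a b g x0 k.+1 x =
  k.+1%:R * (prim (gmono a b g x0 k) x - prim (gmono a b g x0 k) x0).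
Proof.
move=> l /andP[ax0 x0b] /andP[ax xb]; rewrite [LHS]/=.
case: leP => x0x; first by rewrite prim_sub.
by rewrite -mulrN -(prim_sub l ax (ltW x0x) x0b) opprB.
Qed.

Lemma L1_gmono x0 k : a <= x0 <= b -> L1 (gmono a b g x0 k).
Proof.
move=> x0ab; elim: k => [|k IH]; first exact: L1_cst.
pose p := prim (gmono a b g x0 k).
apply: (@L1_eq (fun x => k.+1%:R * (p x - p x0))).
  by move=> x /andP[ax /ltW xb]; rewrite gmonoS ?ax.
by apply/L1Z/L1B; [exact: L1_prim|exact: L1_cst].
Qed.

Lemma Pg_D p q : P p -> P q -> P (p \+ q).
Proof.
move=> [s [hs ->]] [t [ht ->]]; exists (s ++ t); split.
  by move=> u; rewrite mem_cat => /orP[/hs|/ht].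
by apply/funext => x; rewrite /= big_cat.
Qed.

Lemma Pg_Z c p : P p -> P (fun x => c * p x).
Proof.
move=> [s [hs ->]]; exists [seq ((c * t.1.1, t.1.2), t.2) | t <- s]; split.
  by move=> u /mapP[t ts ->] /=; exact: hs.
apply/funext => x; rewrite big_map mulr_sumr; apply: eq_bigr => t _ /=.
by rewrite mulrA.
Qed.

Lemma Pg_gmono x0 k : a <= x0 <= b -> P (gmono a b g x0 k).
Proof.
move=> x0ab; exists [:: ((1, x0), k)]; split => [t|].
  by rewrite inE => /eqP ->.
by apply/funext => x; rewrite big_seq1 mul1r.
Qed.

Lemma Pg_cst c : P (fun=> c).
Proof.
rewrite (_ : (fun=> c) = fun x => c * gmono a b g a 0 x).
  by apply/Pg_Z/Pg_gmono; rewrite lexx ltW.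
by apply/funext => x; rewrite mulr1.
Qed.

(** Integrating a monomial from a instead of from its centre x0 gives the next monomial, up to the
    factor 1/(k+1), plus the constant [prim] at x0. Integrability is proved in the same induction
    because linearity of the integral needs it. *)
Lemma Pg_prim p : P p -> L1 p /\ exists2 q, P q & forall x, a <= x <= b -> prim p x = q x.
Proof.
move=> [s [hs ->]]; elim: s hs => [_|[[c x0] k] s IH hs].
  under eq_fun do rewrite big_nil; split; first exact: L1_cst.
  exists (fun=> 0); first exact: Pg_cst.
  by move=> x _; rewrite /prim Rintegral_cst// mul0r.
have [|l [q Pq qE]] := IH; first by move=> t ts; apply: hs; rewrite inE ts orbT.
have x0ab : a <= x0 <= b by apply: (hs ((c, x0), k)); rewrite mem_head.
have lk := L1_gmono k x0ab.
under eq_fun do rewrite big_cons/=.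
have lc : L1 (fun x => c * gmono a b g x0 k x) by exact: L1Z.
split; first exact: (L1D lc l).
pose d := prim (gmono a b g x0 k) x0.
exists (fun x => (c * (k.+1%:R^-1 * gmono a b g x0 k.+1 x + d)) + q x).
  apply: Pg_D => //; apply/Pg_Z/Pg_D; last exact: Pg_cst.
  by apply: Pg_Z; exact: Pg_gmono.
move=> x /[dup] xab /andP[ax xb]; rewrite (primD lc l)// qE// primZ//.
by congr (_ * _ + _); rewrite gmonoS// mulKf ?pnatr_eq0// /d subrK.
Qed.

Lemma Pg_L1 p : P p -> L1 p.
Proof. by case/Pg_prim. Qed.

Lemma Pg_supcl p : P p -> supcl p.
Proof. by move=> Pp e e0; exists p => // x _; rewrite subrr normr0. Qed.

Lemma supcl_lim f : (forall eps, 0 < eps -> exists2 h, supcl h &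
  forall x, a <= x <= b -> `|f x - h x| < eps) -> supcl f.
Proof.
move=> hf e e0; have [|h sh fh] := hf (e / 2); first by rewrite divr_gt0.
have [|p Pp hp] := sh (e / 2); first by rewrite divr_gt0.
exists p => // x xab; have := fh x xab; have := hp x xab.
have := ler_normD (f x - h x) (h x - p x); rewrite addrA subrK => *; lra.
Qed.

Lemma supcl_eq f h : (forall x, a <= x <= b -> f x = h x) -> supcl f -> supcl h.
Proof.
move=> fh sf; apply: supcl_lim => e e0; exists f => // x /fh ->.
by rewrite subrr normr0.
Qed.

Lemma supclD f h : supcl f -> supcl h -> supcl (f \+ h).
Proof.
move=> sf sh e e0; have [|p Pp fp] := sf (e / 2); first by rewrite divr_gt0.
have [|q Pq hq] := sh (e / 2); first by rewrite divr_gt0.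
exists (p \+ q); first exact: Pg_D.
move=> x xab; have := fp x xab; have := hq x xab => /=.
have := ler_normD (f x - p x) (h x - q x).
by rewrite opprD addrACA => *; lra.
Qed.

Lemma supclZ c f : supcl f -> supcl (fun x => c * f x).
Proof.
(* The added 1 keeps the divisor positive when c = 0. *)
move=> sf e e0; have c0 : 0 < `|c| + 1 by rewrite ltr_wpDl.
have [|p Pp fp] := sf (e / (`|c| + 1)); first by rewrite divr_gt0.
exists (fun x => c * p x); first exact: Pg_Z.
move=> x xab; rewrite -mulrBr normrM.
have := fp x xab; rewrite ltr_pdivlMr// mulrDr mulr1 mulrC.
by have := normr_ge0 (f x - p x) => *; lra.
Qed.

Lemma supcl_cst c : supcl (fun=> c).
Proof. exact/Pg_supcl/Pg_cst. Qed.

Lemma supclB f h : supcl f -> supcl h -> supcl (f \- h).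
Proof.
move=> sf sh; apply: supcl_eq (supclD sf (supclZ (-1) sh)) => x _ /=.
by rewrite mulN1r.
Qed.

Lemma L1cl_lim f : L1 f -> (forall eps, 0 < eps -> exists2 h, L1cl h &
  norm1 (f \- h) < eps) -> L1cl f.
Proof.
move=> lf hf; split => // e e0.
have [|h [lh sh] fh] := hf (e / 2); first by rewrite divr_gt0.
have [|p Pp hp] := sh (e / 2); first by rewrite divr_gt0.
exists p => //; have lp := Pg_L1 Pp.
have := norm1D (L1B lf lh) (L1B lh lp).
rewrite (@eq_norm1 _ (f \- p)); first by move=> *; lra.
by move=> x _ /=; rewrite addrA subrK.
Qed.

Lemma L1cl_eq f h : (forall x, a <= x < b -> f x = h x) -> L1cl f -> L1cl h.
Proof.
move=> fh [lf sf]; split; first exact: L1_eq lf.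
move=> e /sf[p Pp pe]; exists p => //; rewrite (@eq_norm1 _ (f \- p))//.
by move=> x /fh /= ->.
Qed.

Lemma L1clD f h : L1cl f -> L1cl h -> L1cl (f \+ h).
Proof.
move=> [lf sf] [lh sh]; split=> [|e e0]; first exact: L1D.
have [|p Pp fp] := sf (e / 2); first by rewrite divr_gt0.
have [|q Pq hq] := sh (e / 2); first by rewrite divr_gt0.
exists (p \+ q); first exact: Pg_D.
have lp := Pg_L1 Pp; have lq := Pg_L1 Pq.
have := norm1D (L1B lf lp) (L1B lh lq).
rewrite (@eq_norm1 _ ((f \+ h) \- (p \+ q))); first by move=> *; lra.
by move=> x _ /=; rewrite opprD addrACA.
Qed.

Lemma L1clZ c f : L1cl f -> L1cl (fun x => c * f x).
Proof.
move=> [lf sf]; split=> [|e e0]; first exact: L1Z.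
have c0 : 0 < `|c| + 1 by rewrite ltr_wpDl.
have [|p Pp fp] := sf (e / (`|c| + 1)); first by rewrite divr_gt0.
exists (fun x => c * p x); first exact: Pg_Z.
rewrite (@eq_norm1 _ (fun x => c * (f \- p) x)); last first.
  by move=> x _ /=; rewrite mulrBr.
rewrite norm1Z; last exact/L1B/Pg_L1.
move: fp; rewrite ltr_pdivlMr// mulrDr mulr1 mulrC.
by have := norm1_ge0 (f \- p) => *; lra.
Qed.

Lemma L1clB f h : L1cl f -> L1cl h -> L1cl (f \- h).
Proof.
move=> sf sh; apply: L1cl_eq (L1clD sf (L1clZ (-1) sh)) => x _ /=.
by rewrite mulN1r.
Qed.

(** The total mass g b - g a is finite, so a uniform error costs at most that error times the
    mass. *)
Lemma supcl_L1cl f : L1 f -> supcl f -> L1cl f.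
Proof.
move=> lf sf; split => // e e0.
have c0 : 0 < g b - g a + 1 by rewrite ltr_wpDl.
have e1 : 0 < e / (g b - g a + 1) by rewrite divr_gt0.
have [p Pp fp] := sf _ e1; exists p => //.
apply: (@le_lt_trans _ _ (norm1 (fun=> e / (g b - g a + 1)))).
  apply: le_norm1; [exact/L1B/Pg_L1|exact: L1_cst|move=> x /andP[ax xb]].
  by rewrite [leRHS]ger0_norm ?ltW//= fp// ax ltW.
rewrite norm1_cst ?ltW// mulrAC ltr_pdivrMr//.
by rewrite ltr_pM2l// ltrDl.
Qed.

Lemma prim_supcl f : L1cl f -> supcl (prim f).
Proof.
move=> [lf sf]; apply: supcl_lim => e e0.
have [p Pp fp] := sf _ e0; have [lp [q Pq qE]] := Pg_prim Pp.
exists q; first exact: Pg_supcl.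
move=> x /[dup] xab /andP[ax xb]; rewrite -qE// -primB//.
exact: le_lt_trans (le_prim (L1B lf lp) xab) fp.
Qed.

End closures.

(** * Induction along a real interval *)

Section real_induction.
Context {R : realType}.

(** Look at the supremum of the points of [a, b] where Q holds. The left hypothesis carries Q from
    points just below to the supremum itself, and the right hypothesis would produce a larger point
    unless the supremum is b. The right step reaches just one further point, so it may cross a jump
    of g. *)
Lemma real_induction (Q : R -> Prop) (a b : R) : a <= b -> Q a ->
  (forall s, a < s -> s <= b ->
    exists2 r, r < s & forall y, a <= y -> r < y -> y < s -> Q y -> Q s) ->
  (forall s, a <= s -> s < b -> Q s -> exists y, [/\ s < y, y <= b & Q y]) ->
  Q b.
Proof.
move=> ab Qa Ql Qr; pose S := [set y | a <= y <= b /\ Q y].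
have Sa : S a by split => //; rewrite lexx ab.
have hS : has_sup S.
  by split; [exists a|exists b => y [/andP[]]].
have aS : a <= sup S by exact: ub_le_sup (proj2 hS) _ Sa.
have Sb : sup S <= b by apply: ge_sup; [exists a|move=> y [/andP[]]].
have QS : Q (sup S).
  move: (aS); rewrite le_eqVlt => /predU1P[<-//|aS'].
  have [r rs Qrs] := Ql _ aS' Sb.
  have [y [/andP[ay yb] Qy]] : exists2 y, S y & sup S - (sup S - r) < y.
    by apply: sup_adherent => //; rewrite subr_gt0.
  rewrite opprB addrC subrK => ry.
  have : y <= sup S by apply: (ub_le_sup (proj2 hS)); split => //; rewrite ay.
  by rewrite le_eqVlt => /predU1P[<-//|yS]; exact: Qrs Qy.
move: (Sb); rewrite le_eqVlt => /predU1P[<-//|Sb'].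
have [y [Sy yb Qy]] := Qr _ aS Sb' QS.
have : y <= sup S.
  apply: (ub_le_sup (proj2 hS)); split => //.
  by rewrite yb andbT ltW// (le_lt_trans aS).
by rewrite leNgt Sy.
Qed.

End real_induction.

(** * Countability of the jumps and functions supported on them *)

Section jumps.
Context {R : realType} {a b : R} {g : R -> R}.
Hypothesis dg : derivator a b g.

Let ab : a < b. Proof. by case: dg. Qed.
Notation mu := (mug a b g).
Notation D := (Dg a b g).
Notation L1 := (@L1 R a b g).
Notation norm1 := (@norm1 R a b g).
Notation L1cl := (@L1cl R a b g).

Lemma L1_indic (E : set R) : measurable (E : set (measurableTypeR R)) -> L1 (\1_E : R -> R).
Proof.
move=> mE; apply: (L1_bounded dg (M := 1)).
  exact: (@measurable_indic _ (measurableTypeR R) R _ E mE).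
by move=> x _; rewrite indicE; case: (_ \in _); rewrite ?normr1 ?normr0.
Qed.

Lemma L1_mul_indic (f : R -> R) (E : set R) : measurable (E : set (measurableTypeR R)) ->
  L1 f -> L1 (fun x => \1_E x * f x).
Proof.
move=> mE lf.
have mi : measurable_fun (`[a, b[%classic : set (measurableTypeR R)) (\1_E : R -> R).
  exact: (@measurable_indic _ (measurableTypeR R) R _ E mE).
apply: (@integrableMr _ _ _ mu _ _ (\1_E : R -> R) (EFin \o f)) => //.
exists 1; split; first by rewrite num_real.
by move=> r r1 x _ /=; rewrite indicE; case: (_ \in _);
  rewrite ?normr1 ?normr0 ltW// (lt_trans ltr01).
Qed.

Lemma Rintegral_indic (E : set R) (c d : R) : measurable (E : set (measurableTypeR R)) ->
  \int[mu]_(x in `[c, d[) \1_E x = fine (mu (E `&` `[c, d[)).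
Proof. by move=> mE; rewrite /Rintegral integral_indic. Qed.

(** The open intervals between g x and g(x+) are disjoint for distinct jumps, so a rational number
    chosen in each of them encodes the jump. *)
Lemma Dg_inj_nat : exists e : R -> nat, forall x y, D x -> D y -> e x = e y -> x = y.
Proof.
pose q x : rat := if pselect (g x < gplus g x) is left h
  then sval (cid (rat_in_itvoo h)) else 0.
have qP x : D x -> g x < ratr (q x) < gplus g x.
  move=> [_]; rewrite /Deltag subr_gt0 /q; case: pselect => // h _.
  by case: (cid _) => r /=; rewrite in_itv.
have ne x y : D x -> D y -> x < y -> q x != q y.
  move=> Dx Dy xy; apply/eqP => qxy.
  have /andP[_ h1] := qP _ Dx; have /andP[h2 _] := qP _ Dy.
  have [/andP[ax xb] _] := Dx; have [/andP[ay yb] _] := Dy.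
  have := gplus_le dg ax xy (ltW yb); rewrite leNgt => /negP; apply.
  by apply: lt_trans h2 _; rewrite -qxy.
exists (fun x => pickle (q x)) => x y Dx Dy /(pcan_inj (@pickleK _)) qxy.
by case: (ltgtP x y) => // [/(ne _ _ Dx Dy)|/(ne _ _ Dy Dx)]; rewrite qxy eqxx.
Qed.

(** With such a coding fixed, [DS k] collects the jumps of code below k. These finite sets exhaust D
    and grow by at most one point at each step, which permits induction on k. *)
Let eD := sval (cid Dg_inj_nat).
Let eDP := svalP (cid Dg_inj_nat).
Let DS k : set R := [set x | D x /\ (eD x < k)%N].

Let DS_le k : DS k `<=` DS k.+1.
Proof. by move=> x [Dx xk]; split => //; exact: ltnW. Qed.

Let DS_succ k : DS k.+1 = DS k \/
  exists x, [/\ D x, ~ DS k x & DS k.+1 = DS k `|` [set x]].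
Proof.
have [[x Dx xk]|nex] := pselect (exists2 x, D x & eD x = k); last first.
  left; apply/seteqP; split => x; last exact: DS_le.
  move=> [Dx]; rewrite ltnS leq_eqVlt => /predU1P[xk|//].
  by exfalso; apply: nex; exists x.
right; exists x; split => //; first by move=> [_]; rewrite xk ltnn.
apply/seteqP; split => y.
  move=> [Dy]; rewrite ltnS leq_eqVlt => /predU1P[yk|yk]; last by left.
  by right; apply: eDP => //; rewrite [LHS]yk.
by move=> [/DS_le//|->]; split => //; rewrite xk.
Qed.

Let DS_0 : DS 0 = set0.
Proof. by apply/seteqP; split => x // []. Qed.

Let mDS k : measurable (DS k : set (measurableTypeR R)).
Proof.
elim: k => [|k IH]; first by rewrite DS_0.
by case: (DS_succ k) => [->//|[x [_ _ ->]]]; exact: measurableU.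
Qed.

Lemma measurable_Dg : measurable (D : set (measurableTypeR R)).
Proof.
have -> : D = \bigcup_k DS k.
  apply/seteqP; split => x [] //; last by move=> k _ [].
  by move=> ? ?; exists (eD x).+1 => //; split.
exact: bigcup_measurable.
Qed.

(** The sets D minus [DS k] decrease to the empty set, and D lies in [a, b[, which has finite
    measure; continuity from above applies. *)
Let DS_cvg : mu (D `\` DS k) @[k --> \oo] --> 0%E.
Proof.
rewrite [X in _ --> X](_ : _ = mu (\bigcap_k (D `\` DS k))); last first.
  rewrite (_ : \bigcap_k _ = set0) ?measure0//.
  apply/seteqP; split => // x h; have [Dx _] := h 0 I.
  by have [_] := h (eD x).+1 I; apply; split.
have mk k : measurable (D `\` DS k : set (measurableTypeR R)).
  by apply: measurableD; [exact: measurable_Dg|exact: mDS].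
apply: nonincreasing_cvg_mu => //.
- apply: (@le_lt_trans _ _ (mu `[a, b[%classic)); last by rewrite (mug_ab dg) ltry.
  apply: le_measure; rewrite ?inE//.
  by move=> x [[? _] _]; rewrite /= in_itv.
- by apply: bigcap_measurable => // k _.
- move=> n m nm; apply/subsetPset => x [Dx hx]; split => // -[_ xn].
  by apply: hx; split => //; exact: leq_trans nm.
Qed.

Hypothesis jump_L1cl : forall x, D x -> L1cl (ind1 R x).

(** Each new jump x contributes h x times its indicator, so only finite linear combinations of jump
    indicators occur. *)
Let L1cl_DS k (h : R -> R) : L1cl (fun x => \1_(DS k) x * h x).
Proof.
elim: k => [|k IH].
  apply: (L1cl_eq (f := fun=> 0)); first by move=> x _; rewrite DS_0 indic0 mul0r.
  by apply: (supcl_L1cl dg); [exact: (L1_cst dg)|exact: (supcl_cst dg)].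
case: (DS_succ k) => [->//|[x [Dx nx ->]]].
apply: (L1cl_eq (f := (fun y => \1_(DS k) y * h y) \+ (fun y => h x * ind1 R x y))).
  move=> y _ /=; rewrite !indicE in_setU /ind1.
  have [->|yx] := eqVneq y x.
    by rewrite memNset// mem_set//= mul0r mul1r mulr1 add0r.
  have -> : (y \in [set x]) = false; last by rewrite orbF mulr0 addr0.
  by rewrite memNset//= => /eqP; rewrite (negbTE yx).
by apply: (L1clD dg) => //; apply: (L1clZ dg); exact: jump_L1cl.
Qed.

(* The jumps carry finite total mass, so finitely many of them carry all but a small part of it. *)
Lemma L1cl_Dg (h : R -> R) (M : R) : L1 h -> (forall x, a <= x < b -> `|h x| <= M) ->
  L1cl (fun x => \1_D x * h x).
Proof.
move=> lh hM; have lD : L1 (fun x => \1_D x * h x).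
  by apply: L1_mul_indic => //; exact: measurable_Dg.
apply: (L1cl_lim dg) => // e e0.
have M0 : 0 < `|M| + 1 by rewrite ltr_wpDl.
have e1 : 0 < e / (`|M| + 1) by rewrite divr_gt0.
have mD := measurable_Dg.
have [k hk] : exists k, (mu (D `\` DS k) < (e / (`|M| + 1))%:E)%E.
  have /fine_cvgP[[n0 _ fin] /cvgrPdist_lt/(_ _ e1)[n1 _ small]] := DS_cvg.
  exists (maxn n0 n1); have := small (maxn n0 n1) (leq_maxr _ _).
  have := fin (maxn n0 n1) (leq_maxl _ _).
  move=> /fineK fE /=; rewrite sub0r normrN ger0_norm ?fine_ge0// => h1.
  by rewrite -fE lte_fin.
have mk := mDS k; exists (fun x => \1_(DS k) x * h x) => //.
have mDk : measurable (D `\` DS k : set (measurableTypeR R)) by exact: measurableD.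
apply: (@le_lt_trans _ _ (norm1 (fun x => `|M| * \1_(D `\` DS k) x))).
  apply: le_norm1.
  - by apply: L1B => //; exact: L1_mul_indic.
  - by apply: L1Z; exact: L1_indic.
  - move=> x xab /=; rewrite -mulrBl !indicE in_setD.
    have -> : (x \in D)%:R - (x \in DS k)%:R = ((x \in D) && (x \notin DS k))%:R :> R.
      have [xk|xk] := boolP (x \in DS k); rewrite /= ?andbT ?andbF ?subr0//.
      have -> : x \in D by move: xk; rewrite !inE => -[].
      by rewrite subrr.
    rewrite !normrM normr_id mulrC ler_wpM2r//.
    by apply: le_trans (hM x xab) _; exact: ler_norm.
rewrite norm1Z; last exact: L1_indic.
rewrite normr_id.
have -> : norm1 (\1_(D `\` DS k)) = fine (mu (D `\` DS k)).
  transitivity (\int[mu]_(x in `[a, b[) (\1_(D `\` DS k) x : R)).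
    by apply: eq_Rintegral => x _; rewrite ger0_norm// indicE.
  by rewrite Rintegral_indic// setIidl// => x [[? _] _]; rewrite /= in_itv.
have : fine (mu (D `\` DS k)) < e / (`|M| + 1).
  by rewrite -lte_fin fineK// ge0_fin_numE// (lt_trans hk)// ltry.
rewrite ltr_pdivlMr// mulrDr mulr1 mulrC => ?.
have : 0 <= fine (mu (D `\` DS k)) by exact: fine_ge0.
by move=> *; lra.
Qed.

End jumps.

(** * Power estimates and polynomial approximation of the absolute value *)

Section elementary.
Context {R : realType}.

(** A mean value estimate by induction, from t^(n+2) - s^(n+2) = t (t^(n+1) - s^(n+1)) + s^(n+1) (t
    - s). *)
Lemma exprS_sub_bounds (s t : R) n : 0 <= s -> s <= t ->
  n.+1%:R * s ^+ n * (t - s) <= t ^+ n.+1 - s ^+ n.+1 <= n.+1%:R * t ^+ n * (t - s).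
Proof.
move=> s0 st; have t0 := le_trans s0 st.
elim: n => [|n /andP[IH1 IH2]]; first by rewrite !expr0 !expr1 !mulr1 !mul1r !lexx.
have -> : t ^+ n.+2 - s ^+ n.+2 = t * (t ^+ n.+1 - s ^+ n.+1) + s ^+ n.+1 * (t - s).
  by rewrite !exprS; ring.
have st1 : s ^+ n.+1 <= t ^+ n.+1 by rewrite lerXn2r.
apply/andP; split.
  have -> : n.+2%:R * s ^+ n.+1 * (t - s) =
      s * (n.+1%:R * s ^+ n * (t - s)) + s ^+ n.+1 * (t - s).
    by rewrite -natr1 exprS; ring.
  rewrite lerD2r; apply: (le_trans (y := s * (t ^+ n.+1 - s ^+ n.+1))).
    exact: ler_wpM2l.
  by apply: ler_wpM2r => //; rewrite subr_ge0.
have -> : n.+2%:R * t ^+ n.+1 * (t - s) =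
    t * (n.+1%:R * t ^+ n * (t - s)) + t ^+ n.+1 * (t - s).
  by rewrite -natr1 exprS; ring.
by apply: lerD; [exact: ler_wpM2l|apply: ler_wpM2r => //; rewrite subr_ge0].
Qed.

Lemma exprn_lipschitz (T : R) n : exists2 L, 0 <= L &
  forall s t, 0 <= s -> s <= t -> t <= T -> t ^+ n - s ^+ n <= L * (t - s).
Proof.
case: n => [|n]; first by exists 0 => // s t _ _ _; rewrite !expr0 subrr mul0r.
(* This bounds the derivative of t^(n+1) on [0, T]; the absolute value makes it nonnegative whatever
   the sign of T. *)
exists (n.+1%:R * `|T| ^+ n); first by rewrite mulr_ge0.
move=> s t s0 st tT; have /andP[_ h] := exprS_sub_bounds n s0 st.
apply: le_trans h _; apply: ler_wpM2r; first by rewrite subr_ge0.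
apply: ler_wpM2l => //; apply: lerXn2r; rewrite ?nnegrE//.
  exact: le_trans st.
exact: le_trans tT (ler_norm T).
Qed.

(* The iteration p <- p + (t^2 - p^2) / 2 increases to |t|, and the error e satisfies e (1 + k |t| / 2) <= |t| after k steps. *)
Lemma normr_poly_approx (eps : R) : 0 < eps ->
  exists p : {poly R}, forall t, `|t| <= 1 -> `| `|t| - p.[t]| < eps.
Proof.
move=> e0; pose p := fix p k : {poly R} := if k is k'.+1
  then p k' + 2^-1 *: ('X^2 - p k' ^+ 2) else 0.
have H k t : `|t| <= 1 -> 0 <= (p k).[t] <= `|t| /\
    (`|t| - (p k).[t]) * (1 + k%:R * (`|t| / 2)) <= `|t|.
  move=> t1; have t0 := normr_ge0 t.
  elim: k => [|k [/andP[IH0 IH1] IH2]].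
    by rewrite /= horner0 lexx t0 subr0 mul0r addr0 mulr1.
  have E : (p k.+1).[t] = (p k).[t] + 2^-1 * (`|t| ^+ 2 - (p k).[t] ^+ 2).
    by rewrite /= !hornerE real_normK ?num_real.
  rewrite E; move: ((p k).[t]) IH0 IH1 IH2 => q q0 qt.
  move: (`|t|) t0 t1 qt => s s0 s1 qs IH.
  have -> : s - (q + 2^-1 * (s ^+ 2 - q ^+ 2)) = (s - q) * (1 - (s + q) / 2).
    by field.
  have h1 : 0 <= (s - q) * (1 - (s + q) / 2) by apply: mulr_ge0; lra.
  have h2 : 0 <= (s - q) * (s + q) by apply: mulr_ge0; lra.
  split.
    apply/andP; split; first by rewrite !expr2; nra.
    by rewrite !expr2; nra.
  (* What remains is (1 - (s + q)/2) (1 + (k+1) s/2) <= 1 + k s/2. Expanding the left side leaves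
     the right side minus nonnegative terms: q/2 and multiples of the products in [h3] to [h6]. *)
  apply: le_trans IH; rewrite -mulrA; apply: ler_wpM2l; first by lra.
  rewrite -(natr1 k); have : 0 <= k%:R :> R by [].
  move: (k%:R) => c c0.
  have h3 : 0 <= c * (s * q) by rewrite !mulr_ge0.
  have h4 : 0 <= c * (s * s) by rewrite !mulr_ge0.
  have h5 : 0 <= s * s by rewrite !mulr_ge0.
  have h6 : 0 <= s * q by rewrite !mulr_ge0.
  by nra.
(* With k eps > 2, an error of at least eps would force eps + |t| <= eps (1 + k |t| / 2) <= |t|. *)
have [k hk] : exists k : nat, 2 / eps < k%:R.
  by exists (Num.truncn (2 / eps)).+1; rewrite archimedean.Num.Theory.truncnS_gt.
exists (p k) => t /[dup] t1 /H -/(_ k) [/andP[p0 pt] h].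
rewrite ger0_norm ?subr_ge0//.
have k0 : 0 < k%:R :> R by apply: lt_trans hk; rewrite divr_gt0.
move: hk; rewrite ltr_pdivrMr// => hk.
rewrite ltNge; apply/negP => he.
have : eps * (1 + k%:R * (`|t| / 2)) <= `|t|.
  by apply: le_trans h; apply: ler_wpM2r => //; rewrite addr_ge0 ?mulr_ge0.
have : 2 * `|t| <= k%:R * eps * `|t| by rewrite ler_wpM2r// ltW.
by move: (k%:R) (`|t|) => c s; nra.
Qed.

End elementary.

(** * The continuous part u of g, and the ramps and steps in the sup closure *)

Section continuous_part.
Context {R : realType} {a b : R} {g : R -> R}.
Hypothesis dg : derivator a b g.
Notation L1 := (@L1 R a b g).
Notation L1cl := (@L1cl R a b g).
Hypothesis jump_L1cl : forall x, Dg a b g x -> L1cl (ind1 R x).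

Let ab : a < b. Proof. by case: dg. Qed.
Notation mu := (mug a b g).
Notation D := (Dg a b g).
Notation prim := (@prim R a b g).
Notation supcl := (@supcl R a b g).

Let mD : measurable (D : set (measurableTypeR R)).
Proof. exact: measurable_Dg. Qed.
Let mDc : measurable (~` D : set (measurableTypeR R)).
Proof. exact: measurableC. Qed.

Definition contpart : R -> R := prim (\1_(~` D)).
Local Notation u := contpart.

Let lDc : L1 (\1_(~` D) : R -> R). Proof. exact: L1_indic. Qed.

Lemma contpart_sub c d : a <= c -> c <= d -> d <= b ->
  u d - u c = \int[mu]_(x in `[c, d[) \1_(~` D) x.
Proof. by move=> ac cd db; rewrite prim_sub. Qed.

Lemma contpart_homo c d : a <= c -> c <= d -> d <= b -> u c <= u d.
Proof. by apply: prim_homo => // x _; rewrite indicE. Qed.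

Lemma contpart_a : u a = 0. Proof. exact: prim_a. Qed.

Lemma contpart_ge0 c : a <= c -> c <= b -> 0 <= u c.
Proof. by move=> ac cb; rewrite -contpart_a; exact: contpart_homo. Qed.

Lemma contpart_le c d : a <= c -> c <= d -> d <= b -> u d - u c <= g d - g c.
Proof.
move=> ac cd db; rewrite contpart_sub// Rintegral_indic//.
rewrite (_ : g d - g c = fine (mu `[c, d[%classic)); last by rewrite (mug_co dg).
have mcd : measurable (`[c, d[%classic : set (measurableTypeR R)) by exact: measurable_itv.
apply: fine_le; rewrite ?(mug_co dg)//; last first.
  by rewrite -(mug_co dg)//; apply: le_measure; rewrite ?inE//; exact: measurableI.
rewrite ge0_fin_numE//; apply: le_lt_trans (ltry (g d - g c)).
by rewrite -(mug_co dg)//; apply: le_measure; rewrite ?inE//; exact: measurableI.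
Qed.

(** If c is a jump, it is absent from the set that u measures, so only ]c, d[ counts; otherwise
    g(c+) <= g c and [contpart_le] suffices. The two bounds together express the continuity of u,
    from the left by left-continuity of g and from the right because g(c+) replaces g c. *)
Lemma contpart_lt c d : a <= c -> c < d -> d <= b -> u d - u c <= g d - gplus g c.
Proof.
move=> ac cd db; have acb : a <= c < b by rewrite ac (lt_le_trans cd).
have [Dc|nDc] := pselect (D c); last first.
  apply: le_trans (contpart_le ac (ltW cd) db) _; rewrite lerD2l lerN2.
  rewrite -subr_le0 leNgt; apply/negP => h; exact: nDc.
rewrite contpart_sub// ?(ltW cd)// Rintegral_indic//.
rewrite (_ : g d - gplus g c = fine (mu `]c, d[%classic)); last by rewrite (mug_oo dg).
have mcd : measurable (`[c, d[%classic : set (measurableTypeR R)) by exact: measurable_itv.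
have mcd' : measurable (`]c, d[%classic : set (measurableTypeR R)) by exact: measurable_itv.
have le : (mu (~` D `&` `[c, d[) <= mu `]c, d[%classic)%E.
  apply: le_measure; rewrite ?inE//; first exact: measurableI.
  move=> x [/= nDx]; rewrite !in_itv/= => /andP[cx ->]; rewrite andbT.
  by rewrite lt_neqAle cx andbT; apply/eqP => cE; apply: nDx; rewrite -cE.
apply: fine_le => //; last by rewrite (mug_oo dg).
by rewrite ge0_fin_numE//; apply: le_lt_trans le _; rewrite (mug_oo dg)// ltry.
Qed.

Lemma L1_contpart_pow n : L1 (fun x => u x ^+ n).
Proof.
apply: (L1_homo dg) => x y ax xy yb; apply: lerXn2r; rewrite ?nnegrE.
- by apply: contpart_ge0 => //; exact: le_trans yb.
- by apply: contpart_ge0 => //; exact: le_trans xy.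
- exact: contpart_homo.
Qed.

(* Both sides have increments over [c, d[ lying between (n+1) u(c)^n (u(d)-u(c)) and (n+1) u(d)^n (u(d)-u(c)); since u is continuous, the difference grows slower than eps * u. *)
Lemma prim_contpart_pow n x : a <= x <= b ->
  n.+1%:R * prim (fun z => \1_(~` D) z * u z ^+ n) x = u x ^+ n.+1.
Proof.
move=> /andP[ax xb]; set h := fun z => _; pose F y := n.+1%:R * prim h y - u y ^+ n.+1.
suff Fe e : 0 < e -> `|F x| <= e * u x.
  apply/eqP; rewrite -subr_eq0 -/(F x) -normr_le0; apply/ler_addgt0Pl => e e0.
  rewrite addr0; have c0 : 0 < u x + 1 by rewrite ltr_wpDl// contpart_ge0.
  have e1 : 0 < e / (u x + 1) by rewrite divr_gt0.
  apply: le_trans (Fe _ e1) _; rewrite mulrAC ler_pdivrMr// ler_wpM2l ?ltW//.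
  by rewrite ltrDl.
move=> e0; have [L L0 HL] := exprn_lipschitz (u b) n.
have lh : L1 h by apply: L1_mul_indic => //; exact: L1_contpart_pow.
(* If u grows by less than d over a step, then (n+1) L times that growth is at most e; the added 1
   keeps the divisor positive. *)
pose d := e / (n.+1%:R * L + 1).
have c0 : 0 < n.+1%:R * L + 1 by rewrite ltr_wpDl// mulr_ge0.
have d0 : 0 < d by rewrite divr_gt0.
have step y z : a <= y -> y <= z -> z <= b -> u z - u y < d ->
    `|F y| <= e * u y -> `|F z| <= e * u z.
  move=> ay yz zb uyz Fy.
  have uy0 : 0 <= u y by apply: contpart_ge0 => //; exact: le_trans zb.
  have uyz' : u y <= u z by exact: contpart_homo.
  have uzb : u z <= u b by apply: contpart_homo => //; exact: le_trans yz.
  have /andP[b1 b2] := exprS_sub_bounds n uy0 uyz'.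
  have := prim_sub lh ay yz zb; set J := \int[mu]_(_ in _) _ => JE.
  have lJ c : mu.-integrable `[y, z[ (EFin \o (fun w => c * \1_(~` D) w : R)).
    by apply: (L1_sub (a := a) (b := b)) => //; exact: L1Z.
  have IE c : \int[mu]_(w in `[y, z[) (c * \1_(~` D) w) = c * (u z - u y).
    rewrite RintegralZl//; first by rewrite contpart_sub.
    exact: (L1_sub (a := a) (b := b)).
  have hi : mu.-integrable `[y, z[ (EFin \o h) by exact: (L1_sub (a := a) (b := b)).
  have J1 : u y ^+ n * (u z - u y) <= J.
    rewrite -IE; apply: le_Rintegral => // w /=; rewrite in_itv/= => /andP[yw wz].
    rewrite /h mulrC; apply: ler_wpM2l; first by rewrite indicE.
    have wb := ltW (lt_le_trans wz zb).
    apply: lerXn2r; rewrite ?nnegrE//; first exact: (le_trans uy0 (contpart_homo ay yw wb)).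
    exact: contpart_homo.
  have J2 : J <= u z ^+ n * (u z - u y).
    rewrite -IE; apply: le_Rintegral => // w /=; rewrite in_itv/= => /andP[yw wz].
    rewrite /h [leRHS]mulrC; apply: ler_wpM2l; first by rewrite indicE.
    have aw := le_trans ay yw.
    have wb := ltW (lt_le_trans wz zb).
    apply: lerXn2r; rewrite ?nnegrE//.
    - exact: contpart_ge0.
    - exact: le_trans uyz'.
    - by apply: contpart_homo => //; exact: ltW.
  have hL := HL _ _ uy0 uyz' uzb.
  have N0 : 0 <= n.+1%:R :> R by [].
  have J1' : n.+1%:R * (u y ^+ n * (u z - u y)) <= n.+1%:R * J by exact: ler_wpM2l.
  have J2' : n.+1%:R * J <= n.+1%:R * (u z ^+ n * (u z - u y)) by exact: ler_wpM2l.
  have dd : `|F z - F y| <= n.+1%:R * (u z ^+ n - u y ^+ n) * (u z - u y).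
    have -> : F z - F y = n.+1%:R * J - (u z ^+ n.+1 - u y ^+ n.+1).
      by rewrite /F -JE; ring.
    rewrite mulrA in J1'; rewrite mulrA in J2'.
    rewrite (mulrBr n.+1%:R) mulrBl ler_norml; apply/andP; split; lra.
  have w0 : 0 <= u z - u y by rewrite subr_ge0.
  have : n.+1%:R * (u z ^+ n - u y ^+ n) <= e.
    apply: (le_trans (y := n.+1%:R * (L * (u z - u y)))); first exact: ler_wpM2l.
    rewrite mulrA; apply: (le_trans (y := (n.+1%:R * L + 1) * (u z - u y))).
      by rewrite ler_wpM2r// lerDl.
    by rewrite mulrC -ler_pdivlMr// ltW.
  move=> /(ler_wpM2r w0) h2.
  rewrite (_ : F z = F y + (F z - F y)); last by rewrite addrC subrK.
  apply: le_trans (ler_normD _ _) _; lra.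
(* Every point has a left neighbour and, before x, a right neighbour across which u grows by less
   than d, so [step] can be applied on both sides, even at a jump. *)
apply: (real_induction (Q := fun y => `|F y| <= e * u y) ax).
- by rewrite /F prim_a contpart_a mulr0 expr0n subrr normr0 mulr0.
- move=> s as_ sx; have sb := le_trans sx xb.
  have [y0 [ay0 y0s gy0]] := derivator_left dg as_ sb d0.
  exists y0 => // y ay y0y ys; apply: step => //; first exact: ltW.
  apply: le_lt_trans (contpart_le ay (ltW ys) sb) _.
  have := derivator_homo dg ay0 (ltW y0y) (ltW (lt_le_trans ys sb)); lra.
- move=> s as_ sx Fs.
  have asb : a <= s < b by rewrite as_ (lt_le_trans sx).
  have [y [sy yb gy]] := gplus_right dg asb d0.
  have sz : s < Num.min y x by rewrite lt_min sy sx.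
  have zb : Num.min y x <= b by rewrite ge_min yb.
  exists (Num.min y x); split => //; first by rewrite ge_min lexx orbT.
  apply: step Fs => //; first exact: ltW.
  apply: le_lt_trans (contpart_lt as_ sz zb) _.
  have : g (Num.min y x) <= g y.
    by apply: (derivator_homo dg) => //; [exact: le_trans (ltW sz)|rewrite ge_min lexx].
  lra.
Qed.

Lemma supcl_contpart_pow n : supcl (fun x => u x ^+ n).
Proof.
elim: n => [|n IH].
  by apply: supcl_eq (supcl_cst dg 1) => x _; rewrite expr0.
have lu := L1_contpart_pow n.
have cu := supcl_L1cl dg lu IH.
have cD : L1cl (fun x => \1_D x * u x ^+ n).
  apply: (L1cl_Dg dg jump_L1cl (M := u b ^+ n)) => // x /andP[ax /ltW xb].
  have ux := contpart_ge0 ax xb; rewrite ger0_norm ?exprn_ge0//.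
  apply: lerXn2r; rewrite ?nnegrE//; first exact: contpart_ge0 (ltW ab) _.
  exact: contpart_homo.
have cDc : L1cl (fun x => \1_(~` D) x * u x ^+ n).
  apply: L1cl_eq (L1clB dg cu cD) => x _ /=.
  by rewrite !indicE in_setC; case: (_ \in _); rewrite ?mul1r ?mul0r ?subr0 ?subrr.
apply: supcl_eq (supclZ n.+1%:R (prim_supcl dg cDc)) => x.
exact: prim_contpart_pow.
Qed.

Lemma supcl_sum n (F : nat -> R -> R) : (forall i, supcl (F i)) ->
  supcl (fun x => \sum_(i < n) F i x).
Proof.
move=> hF; elim: n => [|n IH].
  by apply: supcl_eq (supcl_cst dg 0) => x _; rewrite big_ord0.
by apply: supcl_eq (supclD IH (hF n)) => x _; rewrite big_ord_recr.
Qed.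

Lemma supcl_contpart_poly (p : {poly R}) : supcl (fun x => p.[u x]).
Proof.
apply: supcl_eq (supcl_sum (size p) (F := fun i x => p`_i * u x ^+ i) _).
  by move=> x _; rewrite horner_coef.
by move=> i; apply: supclZ; exact: supcl_contpart_pow.
Qed.

(** Since min(u, u y) = (u + u y - |u - u y|) / 2, only the absolute value has to be approximated.
    Division by T = u b + 1 brings its argument into [-1, 1]. *)
Lemma supcl_contpart_min y : a <= y <= b -> supcl (fun x => Num.min (u x) (u y)).
Proof.
move=> /andP[ay yb]; pose T := u b + 1.
have T0 : 0 < T by rewrite ltr_wpDl// contpart_ge0// ltW.
have sT : supcl (fun x => `|(u x - u y) / T|).
  apply: supcl_lim => e e0; have [p hp] := normr_poly_approx e0.
  exists (fun x => (p \Po (T^-1 *: ('X - (u y)%:P))).[u x]).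
    exact: supcl_contpart_poly.
  move=> x /andP[ax xb]; rewrite horner_comp !hornerE mulrC; apply: hp.
  rewrite normrM normfV (gtr0_norm T0) mulrC ler_pdivrMr// mul1r ler_norml /T.
  have := contpart_ge0 ax xb; have := contpart_ge0 ay yb.
  have := contpart_homo ax xb (lexx b); have := contpart_homo ay yb (lexx b).
  by move=> *; apply/andP; split; lra.
have su := supcl_contpart_pow 1.
apply: supcl_eq (supclZ 2^-1 (supclB (supclD su (supcl_cst dg (u y))) (supclZ T sT))).
move=> x _ /=; rewrite minr_absE normrM normfV (gtr0_norm T0) mulrCA divff ?gt_eqF//.
by rewrite mulr1 expr1 mulrC.
Qed.

(** Up to y, the primitive of 1_D plus u equals g - g a. Cutting 1_D off at y and u at the value u y
    makes both summands constant beyond y. *)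
Lemma supcl_derivator_min y : a <= y <= b -> supcl (fun x => Num.min (g x) (g y)).
Proof.
move=> /[dup] yab /andP[ay yb].
have mE : measurable (`]-oo, y[%classic : set (measurableTypeR R)) by exact: measurable_itv.
pose h : R -> R := fun x => \1_D x * \1_(`]-oo, y[) x.
have ch : L1cl h.
  apply: (L1cl_Dg dg jump_L1cl (M := 1)); first exact: L1_indic.
  by move=> x _; rewrite indicE; case: (_ \in _); rewrite ?normr1 ?normr0.
have lD : L1 (\1_D : R -> R) by exact: L1_indic.
have Dpart x : a <= x <= b -> prim (\1_D) x + u x = g x - g a.
  move=> /andP[ax xb]; rewrite -primD//.
  transitivity (\int[mu]_(z in `[a, x[) (1 : R)).
    apply: eq_Rintegral => z _ /=; rewrite !indicE in_setC.
    by case: (_ \in _); rewrite ?addr0 ?add0r.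
  by rewrite Rintegral_cst ?mul1r// (mug_co dg).
have prim_h x : a <= x -> x <= y -> prim h x = prim (\1_D) x.
  move=> ax xy; apply: eq_Rintegral => z; rewrite inE/= in_itv/= => /andP[_ zx].
  by rewrite /h [X in _ * X]indicE mem_set ?mulr1//= in_itv/= (lt_le_trans zx).
apply: supcl_eq (supclD (supclD (prim_supcl dg ch) (supcl_contpart_min yab)) (supcl_cst dg (g a))).
move=> x /[dup] xab /andP[ax xb] /=.
have [xy|/ltW yx] := leP x y.
  rewrite prim_h// (min_idPl (contpart_homo ax xy yb)) (min_idPl (derivator_homo dg ax xy yb)).
  by rewrite Dpart// subrK.
have lh : L1 h by case: ch.
have -> : prim h x = prim h y.
  apply/eqP; rewrite -subr_eq0 prim_sub//; apply/eqP.
  transitivity (\int[mu]_(z in `[y, x[) (0 : R)).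
    apply: eq_Rintegral => z; rewrite inE/= in_itv/= => /andP[yz _].
    rewrite /h [X in _ * X]indicE memNset ?mulr0//= in_itv/= => zy.
    by move: (le_lt_trans yz zy); rewrite ltxx.
  by rewrite Rintegral_cst ?mul0r.
rewrite prim_h// (min_idPr (contpart_homo ay yx xb)) (min_idPr (derivator_homo dg ay yx xb)).
by rewrite Dpart// subrK.
Qed.

(** The primitive of the indicator of y jumps by the mass [Deltag g y]. It does so strictly after y,
    since the integral runs over the half-open [a, x). *)
Lemma supcl_jump (y : R) : D y -> supcl (fun x : R => (y < x)%R%:R).
Proof.
move=> /[dup] Dy [/[dup] yab /andP[ay yb] j0].
have m1 : measurable ([set y] : set (measurableTypeR R)) by exact: measurable_set1.
have pE x : a <= x -> prim (ind1 R y) x = fine (mu ([set y] `&` `[a, x[)).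
  move=> ax; rewrite -Rintegral_indic//; apply: eq_Rintegral => z _.
  rewrite /ind1 indicE; case: eqVneq => [->|zy]; first by rewrite mem_set.
  by rewrite memNset//= => /eqP; rewrite (negbTE zy).
apply: supcl_eq (supclZ (Deltag g y)^-1 (prim_supcl dg (jump_L1cl Dy))).
move=> x /andP[ax xb]; rewrite pE//; case: ltP => yx.
  rewrite setIidl ?(mug_set1_jump dg)//= ?mulVf ?gt_eqF//.
  by move=> _ ->; rewrite /= in_itv/= ay.
rewrite (_ : _ `&` _ = set0) ?measure0 ?mulr0//.
apply/seteqP; split => // _ [/= ->]; rewrite in_itv/= => /andP[_ /(le_lt_trans yx)].
by rewrite ltxx.
Qed.

End continuous_part.

(** * The equivalence for real scalars *)

Lemma convex_lt (R : realType) (t x y m : R) : 0 <= t -> t <= 1 -> x < m -> y < m ->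
  (1 - t) * x + t * y < m.
Proof.
move=> t0 t1 xm ym; case: (leP x y) => xy.
  apply: le_lt_trans ym; have : 0 <= (1 - t) * (y - x) by rewrite mulr_ge0 ?subr_ge0.
  lra.
apply: le_lt_trans xm; have : 0 <= t * (x - y) by rewrite mulr_ge0 ?subr_ge0// ltW.
lra.
Qed.

Section real_scalars.
Context {R : realType} {a b : R} {g : R -> R}.
Hypothesis dg : derivator a b g.

Let ab : a < b. Proof. by case: dg. Qed.
Notation mu := (mug a b g).
Notation D := (Dg a b g).
Notation L1 := (@L1 R a b g).
Notation norm1 := (@norm1 R a b g).
Notation L1cl := (@L1cl R a b g).
Notation supcl := (@supcl R a b g).
Notation P := (Pg (@id R) a b g).
Notation UC := (UCg (@Num.norm _ R) a b g).
Notation L2cl := (in_L2_closure_Pg (@id R) (@Num.norm _ R) a b g).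

Let mab : measurable (`[a, b[%classic : set (measurableTypeR R)).
Proof. exact: measurable_itv. Qed.

Lemma L1_ind1 (x : R) : L1 (ind1 R x).
Proof.
apply: (@L1_eq _ _ _ _ (\1_[set x] : R -> R)).
  move=> y _; rewrite /ind1 indicE; case: eqVneq => [->|yx]; first by rewrite mem_set.
  by rewrite memNset//= => /eqP; rewrite (negbTE yx).
by apply: (L1_indic dg); exact: measurable_set1.
Qed.

(** Integrate the pointwise bound |t| <= d + t^2 / d. With m the total mass and d = e / (m + 1), an
    L^2 error below d^2 gives an L^1 error below d m + d = e. *)
Lemma L2cl_L1cl f : L1 f -> L2cl f -> L1cl f.
Proof.
move=> lf sf; split => // e e0.
have m0 : 0 <= g b - g a by rewrite subr_ge0 (derivator_homo dg)// ltW.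
have c0 : 0 < g b - g a + 1 by rewrite ltr_wpDl.
pose d := e / (g b - g a + 1); have d0 : 0 < d by rewrite divr_gt0.
have [p Pp hp] := sf (d ^+ 2) (exprn_gt0 2 d0); exists p => //.
have lF := L1B lf (Pg_L1 dg Pp).
(* The hypothesis is restated by conversion with [mug] in place of [mu_g]. *)
have {}hp : (\int[mu]_(y in `[a, b[) ((`|f y - p y|) ^+ 2)%:E < (d ^+ 2)%:E)%E := hp.
have lF2 : L1 (fun y => `|f y - p y| ^+ 2).
  apply/integrableP; split.
    apply/measurable_EFinP; apply: measurable_funX; apply: measurableT_comp => //.
    by apply/measurable_EFinP; exact: (measurable_int mu lF).
  apply: le_lt_trans (lt_trans hp (ltry _)).
  rewrite le_eqVlt; apply/orP; left; apply/eqP; apply: eq_integral => y _.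
  by rewrite /= ger0_norm// exprn_ge0.
have n2 : norm1 (fun y => `|f y - p y| ^+ 2) < d ^+ 2.
  rewrite -lte_fin /norm1 fineK//.
    by apply: le_lt_trans hp; under eq_integral do rewrite normrX normr_id.
  exact: (integrable_fin_num mab (L1_abs lF2)).
have lR : L1 (fun y => d + d^-1 * `|f y - p y| ^+ 2).
  by apply: L1D; [exact: (L1_cst dg)|exact: L1Z].
apply: (@le_lt_trans _ _ (norm1 (fun y => d + d^-1 * `|f y - p y| ^+ 2))).
  apply: le_norm1 => // y _ /=; move: (f y - p y) => t.
  have h : 0 <= d^-1 * `|t| ^+ 2 by rewrite mulr_ge0// ?invr_ge0 ?ltW// exprn_ge0.
  have h' : 0 <= d + d^-1 * `|t| ^+ 2 by rewrite addr_ge0// ltW.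
  rewrite (ger0_norm h').
  case: (leP `|t| d) => td; first by rewrite ler_wpDr.
  apply: ler_wpDl; first exact: ltW.
  by rewrite mulrC ler_pdivlMr// expr2 ler_wpM2l// ltW.
apply: le_lt_trans (norm1D (L1_cst dg d) (L1Z d^-1 lF2)) _.
rewrite norm1Z// (norm1_cst dg) ?ltW// gtr0_norm ?invr_gt0//.
have : d^-1 * norm1 (fun y => `|f y - p y| ^+ 2) < d.
  by rewrite mulrC ltr_pdivrMr// -expr2.
have -> : e = d * (g b - g a) + d by rewrite /d; field; rewrite gt_eqF.
by move=> ?; rewrite ltrD2l.
Qed.

(** The points to be covered lie at or after the supremum of S, the set where g is at most g x -
    eta. If g exceeds this level at the supremum, the interval closed there has mass below eta. If
    not, the supremum is left out, and its right limit is still at least g x - eta because no point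
    further right belongs to S. *)
Lemma derivator_level_cover (x eta : R) : a <= x -> x <= b -> 0 < eta ->
  exists B : set R, [/\ measurable (B : set (measurableTypeR R)),
    forall y, a <= y -> y < x -> g x - eta < g y -> B y & (mu B <= eta%:E)%E].
Proof.
move=> ax xb e0; pose S := [set y | a <= y <= x /\ g y <= g x - eta].
have [gae|gae] := leP (g a) (g x - eta); last first.
  exists `[a, x[%classic; split; first exact: measurable_itv.
    by move=> y ay yx _; rewrite /= in_itv/= ay.
  by rewrite (mug_co dg)// lee_fin; lra.
have hS : has_sup S.
  split; first by exists a; split => //; rewrite lexx ax.
  by exists x => y [/andP[]].
have aS : a <= sup S by apply: (ub_le_sup (proj2 hS)); split => //; rewrite lexx ax.
have Sx : sup S <= x by apply: ge_sup; [case: hS|move=> y [/andP[]]].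
have above y : a <= y -> y < x -> g x - eta < g y -> sup S <= y.
  move=> ay yx gy; rewrite leNgt; apply/negP => yS.
  have [s [/andP[as_ sx] gs]] : exists2 s, S s & sup S - (sup S - y) < s.
    by apply: sup_adherent => //; rewrite subr_gt0.
  rewrite opprB addrC subrK => ys.
  have := derivator_homo dg ay (ltW ys) (le_trans sx xb); lra.
have [gS|gS] := ltP (g x - eta) (g (sup S)).
  exists `[sup S, x[%classic; split; first exact: measurable_itv.
    by move=> y ay yx gy; rewrite /= in_itv/= above.
  by rewrite (mug_co dg)// lee_fin; lra.
have Sx' : sup S < x.
  rewrite lt_neqAle Sx andbT; apply/eqP => Se; move: gS; rewrite Se; lra.
exists `]sup S, x[%classic; split; first exact: measurable_itv.
  move=> y ay yx gy; rewrite /= in_itv/= yx andbT lt_neqAle above// andbT.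
  by apply/eqP => Se; move: gS; rewrite Se; lra.
rewrite (mug_oo dg)// lee_fin lerBlDl -lerBlDr leNgt; apply/negP => h.
have Sab : a <= sup S < b by rewrite aS (lt_le_trans Sx').
have d0 : 0 < g x - eta - gplus g (sup S) by rewrite subr_gt0.
have [y [Sy yb gy]] := gplus_right dg Sab d0.
have yx : y < x.
  rewrite ltNge; apply/negP => xy; have := derivator_homo dg ax xy yb; lra.
have : y <= sup S.
  apply: (ub_le_sup (proj2 hS)); split; last by lra.
  by rewrite (ltW yx) andbT (le_trans aS)// ltW.
by rewrite leNgt Sy.
Qed.

(** As a function of the value g y, the tent is Lipschitz with constant k. *)
Lemma UC_tent (x k : R) : 0 < k -> UC (fun y => Num.max 0 (1 - k * `|g y - g x|)).
Proof.
move=> k0 e e0; exists (e / k); first by rewrite divr_gt0.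
move=> y z _ _; rewrite ltr_pdivlMr// mulrC => gyz.
have h : `|k * `|g y - g x| - k * `|g z - g x| | <= k * `|g y - g z|.
  rewrite -mulrBr normrM gtr0_norm//; apply: ler_wpM2l; first exact: ltW.
  apply: le_trans (ler_dist_dist _ _) _.
  by rewrite opprB addrA subrK.
have {h} := le_lt_trans h gyz.
move: (k * `|g y - g x|) (k * `|g z - g x|) => s t; rewrite ltr_norml => /andP[h1 h2].
rewrite ltr_norml /Num.max.
by case: (ltP 0 (1 - s)) => h3; case: (ltP 0 (1 - t)) => h4; apply/andP; split; lra.
Qed.

(** A tent of half-width eta <= [Deltag g x] in the values of g vanishes to the right of x, where g
    has already risen by eta. To the left it lives on a set B of mass at most eta, so it is
    L^2-close to the indicator. *)
Lemma dense_jump_L2cl : Pg_dense_UCg (@id R) (@Num.norm _ R) a b g ->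
  forall x, D x -> L2cl (ind1 R x).
Proof.
move=> dense x /[dup] Dx [/[dup] xab /andP[ax xb] J0] e e0.
have m0 : 0 <= g b - g a by rewrite subr_ge0 (derivator_homo dg)// ltW.
pose eta := Num.min (Deltag g x) (e / 8).
have eta0 : 0 < eta by rewrite lt_min J0 divr_gt0.
have etaJ : eta <= Deltag g x by rewrite ge_min lexx.
have etae : eta <= e / 8 by rewrite ge_min lexx orbT.
have [B [mB hB muB]] := derivator_level_cover ax (ltW xb) eta0.
(* As d <= 1, the squared error (1_B + d)^2 is at most 2 1_B + 2 d, whose integral is at most 2 eta
   + 2 d (g b - g a) <= e / 2. *)
pose d := Num.min 1 (e / (8 * (g b - g a + 1))).
have c0 : 0 < g b - g a + 1 by rewrite ltr_wpDl.
have d0 : 0 < d by rewrite lt_min ltr01 divr_gt0// mulr_gt0.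
have d1 : d <= 1 by rewrite ge_min lexx.
have de : d * (g b - g a) <= e / 8.
  apply: (le_trans (y := d * (g b - g a + 1))); first by rewrite ler_wpM2l ?ltW// ltrDl.
  rewrite -ler_pdivlMr// -mulrA -invfM ge_min; apply/orP; right.
  by rewrite lexx.
have ki0 : 0 < eta^-1 by rewrite invr_gt0.
have [p Pp hp] := dense _ (UC_tent x ki0) _ d0.
exists p => //.
have bound y : a <= y < b -> `|ind1 R x y - p y| ^+ 2 <= 2 * \1_B y + 2 * d.
  move=> /andP[ay yb]; have := hp y; rewrite in_itv/= ay (ltW yb) => /(_ isT).
  set f := Num.max _ _ => fp.
  have fB : `|ind1 R x y - f| <= \1_B y.
    rewrite /ind1 /f indicE; case: (ltgtP y x) => [yx|xy|->]; last first.
    - by rewrite subrr normr0 mulr0 subr0 (max_idPr _)// subrr normr0.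
    - have := gplus_le dg ax xy (ltW yb) => h.
      have h1 : eta <= g y - g x by apply: le_trans etaJ _; rewrite /Deltag lerD2r.
      rewrite (max_idPl _) ?subrr ?normr0//.
      rewrite ger0_norm ?(le_trans (ltW eta0))// subr_le0 mulrC.
      by rewrite ler_pdivlMr// mul1r.
    - have gyx := derivator_homo dg ay (ltW yx) (ltW xb).
      rewrite sub0r normrN (ger0_norm (x := Num.max _ _)); last first.
        by rewrite le_max lexx.
      have [h|h] := ltP (g x - eta) (g y).
        rewrite mem_set; last exact: hB.
        rewrite ge_max ler01/= gerBl mulr_ge0// ltW//.
      rewrite (max_idPl _)// distrC ger0_norm ?subr_ge0// subr_le0 mulrC.
      by rewrite ler_pdivlMr// mul1r; lra.
  have h : `|ind1 R x y - p y| <= \1_B y + d.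
    have := ler_normD (ind1 R x y - f) (f - p y); rewrite addrA subrK => h.
    by apply: le_trans h _; apply: lerD => //; exact: ltW.
  apply: (le_trans (y := (\1_B y + d) ^+ 2)).
    have h0 : 0 <= \1_B y + d by rewrite addr_ge0 ?(ltW d0)// indicE.
    by apply: lerXn2r.
  by rewrite indicE; case: (_ \in _); rewrite /= expr2; nra.
have lF : L1 (fun y => ind1 R x y - p y).
  by apply: L1B; [exact: L1_ind1|exact: (Pg_L1 dg)].
have lR : L1 (fun y => 2 * \1_B y + 2 * d : R).
  by apply: L1D; [apply: L1Z; exact: (L1_indic dg)|exact: (L1_cst dg)].
apply: (@le_lt_trans _ _ (\int[mu]_(y in `[a, b[) (2 * \1_B y + 2 * d)%:E)%E).
  apply: ge0_le_integral => //=.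
  - apply/measurable_EFinP; apply: measurable_funX; apply: measurableT_comp => //.
    by apply/measurable_EFinP; exact: (measurable_int mu lF).
  - exact: (measurable_int mu lR).
rewrite -[ltLHS]fineK; last exact: (integrable_fin_num mab lR).
rewrite lte_fin -/(Rintegral mu _ _).
have lB : L1 (\1_B : R -> R) by exact: (L1_indic dg).
rewrite RintegralD//; [|exact: L1Z|exact: (L1_cst dg)].
rewrite RintegralZl// Rintegral_indic// Rintegral_cst// (mug_ab dg)/=.
have : fine (mu (B `&` `[a, b[)) <= eta.
  have le : (mu (B `&` `[a, b[) <= eta%:E)%E.
    apply: le_trans muB; apply: le_measure; rewrite ?inE//; exact: measurableI.
  rewrite -lee_fin fineK// ge0_fin_numE//; exact: le_lt_trans le (ltry _).
by move: (fine _) => r; lra.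
Qed.

(** By real induction on y, some h in the sup closure follows f within e / 2 on [a, y] and stays
    frozen at f y from y on. It is prolonged by a ramp in g where g varies by less than d, and by a
    step at a jump. *)
Lemma jump_L1cl_supcl : (forall x, D x -> L1cl (ind1 R x)) ->
  forall f, UC f -> supcl f.
Proof.
move=> hJ f fUC e e0.
have e20 : 0 < e / 2 by rewrite divr_gt0.
have UCf e' : 0 < e' -> exists2 d, 0 < d & forall x y, a <= x <= b -> a <= y <= b ->
    `|g x - g y| < d -> `|f x - f y| < e'.
  by move=> /fUC[d d0 hd]; exists d => // x y xab yab; apply: hd; rewrite in_itv.
(* f is determined by the value of g, which handles the intervals where g is constant. *)
have feq x y : a <= x <= b -> a <= y <= b -> g x = g y -> f x = f y.
  move=> xab yab gxy; apply/eqP; rewrite -subr_eq0 -normr_le0; apply/ler_addgt0Pl.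
  move=> e' e'0; rewrite addr0; have [d d0 hd] := UCf _ e'0.
  by apply/ltW/hd => //; rewrite gxy subrr normr0.
have [d d0 hd] := UCf _ e20.
pose Q y := exists h, [/\ supcl h, forall x, y <= x <= b -> h x = f y &
  forall x, a <= x <= y -> `|f x - h x| < e / 2].
suff [h [ch _ hf]] : Q b.
  have [p Pp hp] := ch _ e20; exists p => // x xab.
  have := hp x xab; have := hf x xab.
  have := ler_normD (f x - h x) (h x - p x); rewrite addrA subrK; lra.
have ramp y z : a <= y -> y < z -> z <= b -> g z - g y < d -> Q y -> Q z.
  move=> ay yz zb gyz [h [ch hy hf]].
  have yb := le_trans (ltW yz) zb; have az := le_trans ay (ltW yz).
  have yab : a <= y <= b by rewrite ay.
  have zab : a <= z <= b by rewrite az.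
  have gyz0 := derivator_homo dg ay (ltW yz) zb.
  (* If g is constant on [y, z], the slope below would divide by zero; f is then constant there as
     well and the old h serves. *)
  have [gE|gN] := eqVneq (g y) (g z).
    have fyz := feq _ _ yab zab gE.
    exists h; split => //.
      by move=> x /andP[zx xb]; rewrite hy ?xb ?(le_trans (ltW yz)).
    move=> x /andP[ax xz]; have [xy|/ltW yx] := leP x y; first by rewrite hf ?ax.
    have xb := le_trans xz zb.
    rewrite hy ?yx// (feq x y) ?subrr ?normr0 ?ax//.
    apply/eqP; rewrite eq_le (derivator_homo dg ay yx xb) andbT gE.
    exact: (derivator_homo dg).
  have gyz1 : 0 < g z - g y by rewrite subr_gt0 lt_neqAle gN.
  exists (fun x => h x + (f z - f y) / (g z - g y) *
    (Num.min (g x) (g z) - Num.min (g x) (g y))); split.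
  - apply: supclD => //; apply: supclZ; apply: supclB;
      exact: (supcl_derivator_min dg hJ).
  - move=> x /andP[zx xb]; have yx := le_trans (ltW yz) zx.
    rewrite hy ?yx// (min_idPr (derivator_homo dg az zx xb)).
    rewrite (min_idPr (derivator_homo dg ay yx xb)) divfK ?gt_eqF//.
    by rewrite addrC subrK.
  - move=> x /andP[ax xz]; have xb := le_trans xz zb.
    rewrite (min_idPl (derivator_homo dg ax xz zb)).
    have [xy|/ltW yx] := leP x y.
      rewrite (min_idPl (derivator_homo dg ax xy yb)) subrr mulr0 addr0.
      by rewrite hf// ax.
    have g1 := derivator_homo dg ay yx xb; have g2 := derivator_homo dg ax xz zb.
    rewrite (min_idPr g1) hy ?yx//.
    pose t := (g x - g y) / (g z - g y).
    have t0 : 0 <= t by rewrite divr_ge0 ?subr_ge0.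
    have t1 : t <= 1 by rewrite ler_pdivrMr// mul1r lerD2r.
    (* The ramp interpolates f y and f z linearly in g, so its error at x is a convex combination of
       two errors below e / 2. *)
    have -> : f x - (f y + (f z - f y) / (g z - g y) * (g x - g y)) =
        (1 - t) * (f x - f y) + t * (f x - f z).
      by rewrite /t; field; rewrite gt_eqF.
    have xab : a <= x <= b by rewrite ax.
    have f1 : `|f x - f y| < e / 2.
      by apply: hd => //; rewrite ger0_norm ?subr_ge0//; lra.
    have f2 : `|f x - f z| < e / 2.
      by apply: hd => //; rewrite distrC ger0_norm ?subr_ge0//; lra.
    move: f1 f2; rewrite !ltr_norml => /andP[? ?] /andP[? ?].
    apply/andP; split; last exact: convex_lt.
    rewrite ltrNl (_ : - _ = (1 - t) * (f y - f x) + t * (f z - f x)); last by ring.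
    by apply: convex_lt => //; lra.
apply: (real_induction (Q := Q) (ltW ab)).
- exists (fun=> f a); split => //; first exact: (supcl_cst dg).
  move=> x /andP[ax xa]; rewrite (_ : x = a) ?subrr ?normr0//.
  by apply/eqP; rewrite eq_le xa.
- move=> s as_ sb; have [r [ar rs gr]] := derivator_left dg as_ sb d0.
  exists r => // y ay ry ys; apply: ramp => //.
  have := derivator_homo dg ar (ltW ry) (ltW (lt_le_trans ys sb)); lra.
move=> s as_ sb Qs; have sab : a <= s < b by rewrite as_.
have [y [sy yb gy]] := gplus_right dg sab d0.
exists y; split => //.
(* Only g y - g(s+) < d is known. Without a jump this is enough for a ramp; at a jump, the step from
   f s to f y works because on ]s, y] the values of g lie between g(s+) and g y. *)
have [Ds|nDs] := pselect (D s); last first.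
  apply: ramp Qs => //.
  have : Deltag g s <= 0 by rewrite leNgt; apply/negP => h; exact: nDs.
  by rewrite /Deltag; lra.
have [h [ch hs hf]] := Qs.
exists (fun x => h x + (f y - f s) * (s < x)%R%:R); split.
- by apply: supclD => //; apply: supclZ; exact: (supcl_jump dg hJ).
- move=> x /andP[yx xb]; have sx := lt_le_trans sy yx.
  by rewrite hs ?(ltW sx)// sx mulr1 addrC subrK.
- move=> x /andP[ax xy]; have xb := le_trans xy yb.
  have [sx|xs] := ltP s x; last by rewrite mulr0 addr0 hf// ax.
  rewrite hs ?(ltW sx)// mulr1 addrCA subrr addr0.
  apply: hd; rewrite ?ax ?yb ?(le_trans ax)//.
  have := gplus_le dg as_ sx xb; have := derivator_homo dg ax xy yb.
  by move=> ? ?; rewrite distrC ger0_norm ?subr_ge0//; lra.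
Qed.

Lemma dense_iff_jump_L2cl : Pg_dense_UCg (@id R) (@Num.norm _ R) a b g <->
  forall x, D x -> L2cl (ind1 R x).
Proof.
split; first exact: dense_jump_L2cl.
move=> hJ f fUC e e0.
have [x Dx|p Pp hp] := jump_L1cl_supcl _ fUC e0.
  by apply: L2cl_L1cl; [exact: L1_ind1|exact: hJ].
by exists p => // x; rewrite in_itv; exact: hp.
Qed.

End real_scalars.

(** * Reduction of complex scalars to real ones *)

Section complex_scalars.
Context {R : realType} {a b : R} {g : R -> R}.

Notation normc := (@ComplexField.Normc.normc R).
Notation emb := (fun r : R => r%:C%C).
Notation PR := (Pg (@id R) a b g).
Notation PC := (Pg emb a b g).
Notation UCR := (UCg (@Num.norm _ R) a b g).
Notation UCC := (UCg normc a b g).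

Lemma normc_ge0 (z : R[i]) : 0 <= normc z.
Proof. by case: z => x y /=; exact: sqrtr_ge0. Qed.

Lemma normc_sqr (z : R[i]) : normc z ^+ 2 = complex.Re z ^+ 2 + complex.Im z ^+ 2.
Proof. by case: z => x y /=; rewrite sqr_sqrtr// addr_ge0 ?sqr_ge0. Qed.

Lemma normr_Re_le (z : R[i]) : `|complex.Re z| <= normc z.
Proof.
case: z => x y /=; rewrite -sqrtr_sqr ler_sqrt ?addr_ge0 ?sqr_ge0//.
by rewrite lerDl sqr_ge0.
Qed.

Lemma normr_Im_le (z : R[i]) : `|complex.Im z| <= normc z.
Proof.
case: z => x y /=; rewrite -sqrtr_sqr ler_sqrt ?addr_ge0 ?sqr_ge0//.
by rewrite lerDr sqr_ge0.
Qed.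

Lemma normc_le (z : R[i]) : normc z <= `|complex.Re z| + `|complex.Im z|.
Proof.
rewrite -(ler_pXn2r (n := 2))// ?nnegrE ?normc_ge0 ?addr_ge0//.
rewrite normc_sqr sqrrD !real_normK ?num_real// addrAC lerDl.
by rewrite mulrn_wge0// mulr_ge0.
Qed.

Lemma normc_real (r : R) : normc (r%:C)%C = `|r|.
Proof. by rewrite /= expr0n addr0 sqrtr_sqr. Qed.

(** The monomials are real-valued, so taking the real part acts on the coefficients alone. *)
Lemma Pg_Re (p : R -> R[i]) : PC p -> PR (fun x => complex.Re (p x)).
Proof.
move=> [s [hs ->]]; exists [seq ((complex.Re t.1.1, t.1.2), t.2) | t <- s]; split.
  by move=> t /mapP[u us ->] /=; exact: hs.
apply/funext => x; rewrite big_map; elim: s {hs} => [|[[[c d] x0] k] s IH].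
  by rewrite !big_nil.
rewrite !big_cons -IH /=; move: (\sum_(_ <- s) _ * _) => -[u v] /=.
by rewrite mulr0 subr0.
Qed.

Lemma Pg_Im (p : R -> R[i]) : PC p -> PR (fun x => complex.Im (p x)).
Proof.
move=> [s [hs ->]]; exists [seq ((complex.Im t.1.1, t.1.2), t.2) | t <- s]; split.
  by move=> t /mapP[u us ->] /=; exact: hs.
apply/funext => x; rewrite big_map; elim: s {hs} => [|[[[c d] x0] k] s IH].
  by rewrite !big_nil.
rewrite !big_cons -IH /=; move: (\sum_(_ <- s) _ * _) => -[u v] /=.
by rewrite mulr0 add0r.
Qed.

Lemma Pg_complex (p q : R -> R) : PR p -> PR q -> PC (fun x => (p x +i* q x)%C).
Proof.
move=> [s [hs ->]] [t [ht ->]].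
exists ([seq (((u.1.1)%:C%C, u.1.2), u.2) | u <- s] ++
  [seq (((0 +i* u.1.1)%C, u.1.2), u.2) | u <- t]); split.
  move=> w; rewrite mem_cat => /orP[] /mapP[u us ->] /=; [exact: hs|exact: ht].
apply/funext => x; rewrite big_cat !big_map/=.
have -> : \sum_(u <- s) (u.1.1)%:C%C * (gmono a b g u.1.2 u.2 x)%:C%C =
    ((\sum_(u <- s) u.1.1 * gmono a b g u.1.2 u.2 x)%:C)%C.
  by rewrite rmorph_sum/=; apply: eq_bigr => u _; rewrite rmorphM.
have -> : \sum_(u <- t) (0 +i* u.1.1)%C * (gmono a b g u.1.2 u.2 x)%:C%C =
    (0 +i* \sum_(u <- t) u.1.1 * gmono a b g u.1.2 u.2 x)%C.
  elim: t {ht} => [|u t IH]; first by rewrite !big_nil.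
  rewrite !big_cons IH; move: (\sum_(_ <- t) _) => v.
  by apply/eqP; rewrite eq_complex /= !mul0r mulr0 subr0 !add0r !eqxx.
by apply/eqP; rewrite eq_complex /= addr0 add0r !eqxx.
Qed.

Lemma UCg_Re (f : R -> R[i]) : UCC f -> UCR (fun x => complex.Re (f x)).
Proof.
move=> hf e /hf[d d0 hd]; exists d => // x y xab yab /(hd _ _ xab yab).
by apply: le_lt_trans; apply: le_trans (normr_Re_le _); rewrite raddfB.
Qed.

Lemma UCg_Im (f : R -> R[i]) : UCC f -> UCR (fun x => complex.Im (f x)).
Proof.
move=> hf e /hf[d d0 hd]; exists d => // x y xab yab /(hd _ _ xab yab).
by apply: le_lt_trans; apply: le_trans (normr_Im_le _); rewrite raddfB.
Qed.

(** A real f is approximated by the real part of a complex approximant; a complex f by approximating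
    both parts within e / 2. *)
Lemma dense_complexE : Pg_dense_UCg emb normc a b g <->
  Pg_dense_UCg (@id R) (@Num.norm _ R) a b g.
Proof.
split=> dense f fUC e e0.
  have fC : UCC (fun x => (f x)%:C%C).
    move=> e' /fUC[d d0 hd]; exists d => // x y xab yab /(hd _ _ xab yab).
    by rewrite -rmorphB normc_real.
  have [p Pp hp] := dense _ fC _ e0.
  exists (fun x => complex.Re (p x)); first exact: Pg_Re.
  move=> x /hp; apply: le_lt_trans; apply: le_trans (normr_Re_le _).
  by rewrite raddfB.
have e20 : 0 < e / 2 by rewrite divr_gt0.
have [p Pp hp] := dense _ (UCg_Re fUC) _ e20.
have [q Pq hq] := dense _ (UCg_Im fUC) _ e20.
exists (fun x => (p x +i* q x)%C); first exact: Pg_complex.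
move=> x xab; apply: le_lt_trans (normc_le _) _; rewrite !raddfB/=.
by have := hp x xab; have := hq x xab; lra.
Qed.

Hypothesis dg : derivator a b g.

(** Passing to the real part of an approximant does not increase its distance to a real function.
    Integrability of f supplies the measurability needed to compare the two integrals. *)
Lemma L2cl_complexE (f : R -> R) : L1 (a := a) (b := b) (g := g) f ->
  in_L2_closure_Pg emb normc a b g (fun x => (f x)%:C%C) <->
  in_L2_closure_Pg (@id R) (@Num.norm _ R) a b g f.
Proof.
move=> lf; split=> hf e /hf[p Pp hp].
  exists (fun x => complex.Re (p x)); first exact: Pg_Re.
  apply: le_lt_trans hp.
  have PIm := Pg_Im Pp.
  have mab : measurable (`[a, b[%classic : set (measurableTypeR R)) by exact: measurable_itv.
  have mf h : L1 (a := a) (b := b) (g := g) h ->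
      measurable_fun (`[a, b[%classic : set (measurableTypeR R)) h.
    by move=> lh; apply/measurable_EFinP; exact: (measurable_int (mug a b g) lh).
  have lRe := L1B lf (Pg_L1 dg (Pg_Re Pp)).
  have lIm := Pg_L1 dg PIm.
  apply: (@ge0_le_integral _ _ _ (mug a b g)) => //=.
  - apply/measurable_EFinP; apply: measurable_funX; apply: measurableT_comp => //.
    exact: mf lRe.
  - apply/measurable_EFinP.
    (* The squared modulus is measurable as the sum of the squares of its real and imaginary
       parts. *)
    have mF : measurable_fun (`[a, b[%classic : set (measurableTypeR R))
        (fun y : R => (f y - complex.Re (p y)) ^+ 2 + complex.Im (p y) ^+ 2).
      by apply: measurable_funD; apply: measurable_funX; [exact: mf lRe|exact: mf lIm].
    apply: eq_measurable_fun mF => y _.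
    by rewrite normc_sqr !raddfB/= sub0r sqrrN.
  move=> y _; rewrite lee_fin.
  apply: lerXn2r; rewrite ?nnegrE ?normc_ge0//.
  by apply: le_trans (normr_Re_le _); rewrite raddfB.
exists (fun x => (p x +i* 0)%C).
  by apply: Pg_complex Pp _; exact: (Pg_cst dg).
apply: le_lt_trans hp; rewrite le_eqVlt; apply/orP; left; apply/eqP.
by apply: eq_integral => y _; rewrite -[(p y +i* 0)%C]/((p y)%:C)%C -rmorphB normc_real.
Qed.

End complex_scalars.

(* The statement holds for F = R and for F = C (conjunction). *)
Theorem mainTheorem8 (R : realType) (a b : R) (g : R -> R) :
  derivator a b g ->
  (Pg_dense_UCg (@id R) (@Num.norm _ R) a b g <->
     (forall x, Dg a b g x ->
        in_L2_closure_Pg (@id R) (@Num.norm _ R) a b g (ind1 R x)))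
  /\
  (Pg_dense_UCg (fun r : R => r%:C%C) (@ComplexField.Normc.normc R) a b g <->
     (forall x, Dg a b g x ->
        in_L2_closure_Pg (fun r : R => r%:C%C) (@ComplexField.Normc.normc R) a b g
          (ind1 R[i] x))).
Proof.
move=> dg; have main := dense_iff_jump_L2cl dg; split => //.
have indE x : ind1 R[i] x = (fun y => (ind1 R x y)%:C%C).
  by apply/funext => y; rewrite /ind1; case: ifP.
rewrite dense_complexE main; split => h x Dx.
  by rewrite indE; apply/(L2cl_complexE dg); [exact: (L1_ind1 dg)|exact: h].
by apply/(L2cl_complexE dg); [exact: (L1_ind1 dg)|rewrite -indE; exact: h].
Qed.
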